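(* (i) Let $V$ be $\mathbb{R}^{1,1}$ (with $\varsigma=-1$) or $\mathbb{R}^{0,2}$ (with $\varsigma=+1$), let $S=\mathsf{S}=\mathbb{R}^2$ be the irreducible real pinor module, let $B$ be either of the two admissible bilinears on $\mathsf{S}$ (distinguished by $\varsigma_B=\pm1$), let $\kappa$ be the Dirac current associated to $B$, and let $\mathfrak{s}$ be the flat model superalgebra defined by $(V,S,\kappa)$. Then $$\mathsf{H}^{2,2}(\mathfrak{s}_-;\mathfrak{s})\cong\mathbb{R}$$ as an $\mathfrak{s}_0=\mathfrak{so}(V)$-module (trivial module). Moreover, the space $\mathcal{H}^{2,2}$ of normalised cocycles consists exactly of the elements $\beta+\gamma$ of the following form, for $b\in\mathbb{R}$: writing $\beta_\mu=\beta(e_\mu,-)\in\operatorname{End}S$ and $\gamma(s,s)_{\mu\nu}=\eta(e_\mu,\gamma(s,s)e_\nu)$, $$\beta_\mu=b\,\varepsilon_{\mu\nu}\Gamma^\nu,\qquad \gamma(s,s)_{\mu\nu}=2b\,\varepsilon_{\mu\nu}B(s,s)\qquad\text{if }\varsigma_B=+1,$$ $$\beta_\mu=b\,\Gamma_\mu,\qquad \gamma(s,s)_{\mu\nu}=-2b\,\varepsilon_{\mu\nu}B(s,\Gamma_*s)\qquad\text{if }\varsigma_B=-1.$$ (ii) Let $V=\mathbb{R}^{1,1}$ and $S=\mathsf{S}_+$. Then there is, up to rescaling, a unique non-trivial Dirac current $\kappa\colon\operatorname{Sym}^2S\to V$ (i.e. $\mathfrak{so}(V)$-equivariant linear map), and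 for the corresponding flat model superalgebra $\mathfrak{s}$ we have $\mathsf{H}^{2,2}(\mathfrak{s}_-;\mathfrak{s})=0$.
   Context: Clifford conventions. $(V,\eta)$ is one of: signature $(1,1)$, $V=\mathbb{R}^{1,1}$ with orthonormal basis $e_0,e_1$, $\eta_{00}=-1$, $\eta_{11}=+1$; or ''signature $(0,2)$'', $V=\mathbb{R}^{0,2}$ with orthonormal basis $e_1,e_2$ and $\eta$ positive-definite. Set $\varsigma=\det[\eta]$. The Clifford relation is $v\cdot v=+\eta(v,v)\mathbb{1}$. Let $\sigma_1=\begin{pmatrix}0&1\\1&0\end{pmatrix}$, $\sigma_3=\begin{pmatrix}1&0\\0&-1\end{pmatrix}$, $\Omega=\begin{pmatrix}0&1\\-1&0\end{pmatrix}$. The pinor module is $\mathsf{S}=\mathbb{R}^2$ with $e_\mu$ acting by $\Gamma_\mu$, where in signature $(1,1)$: $\Gamma_0=\Omega$, $\Gamma_1=\sigma_1$, $\Gamma_*=\Gamma_0\Gamma_1=\sigma_3$; in signature $(0,2)$: $\Gamma_1=\sigma_3$, $\Gamma_2=\sigma_1$, $\Gamma_*=\Gamma_1\Gamma_2=\Omega$. Indices are raised and lowered with $\eta$, repeated indices are summed; $\varepsilon_{\mu\nu}$ is the antisymmetric symbol with $\varepsilon_{01}=+1$ in signature $(1,1)$, $\varepsilon_{12}=+1$ in signature $(0,2)$; $\Gamma^{\mu\nu}=\Gamma^{[\mu}\Gamma^{\nu]}=\varepsilon^{\mu\nu}\Gamma_*$. An element $A\in\mathfrak{so}(V)$ acts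 on $\mathsf{S}$ by $A\cdot s=\tfrac14A_{\mu\nu}\Gamma^{\mu\nu}s$ with $A_{\mu\nu}=\eta(e_\mu,Ae_\nu)$. In signature $(1,1)$, $\mathsf{S}=\mathsf{S}_+\oplus\mathsf{S}_-$ as $\mathfrak{so}(V)$-module, where $\mathsf{S}_\pm$ are the $\pm1$ eigenspaces of $\Gamma_*$. Admissible bilinears. In signature $(1,1)$: $B(\epsilon,\epsilon')=\epsilon^{T}\sigma_1\epsilon'$ (symmetric, $\varsigma_B=+1$) and $B(\epsilon,\epsilon')=\epsilon^T\Omega\epsilon'$ (skew, $\varsigma_B=-1$). In signature $(0,2)$: $B(\epsilon,\epsilon')=\epsilon^T\epsilon'$ ($\varsigma_B=+1$) and $B(\epsilon,\epsilon')=\epsilon^T\Omega\epsilon'$ ($\varsigma_B=-1$). The associated Dirac current is the symmetric $\mathfrak{so}(V)$-equivariant map $\kappa\colon\operatorname{Sym}^2\mathsf{S}\to V$ with $\eta(\kappa(\epsilon,\epsilon'),v)=B(\epsilon,v\cdot\epsilon')$. Flat model superalgebra. Given $V$, $S$ and a Dirac current $\kappa\colon\operatorname{Sym}^2S\to V$, $\mathfrak{s}=\mathfrak{s}_{-2}\oplus\mathfrak{s}_{-1}\oplus\mathfrak{s}_0$ with $\mathfrak{s}_{-2}=V$, $\mathfrak{s}_{-1}=S$ (odd), $\mathfrak{s}_0=\mathfrak{so}(V)$ is the $\mathbb{Z}$-graded Lie superalgebra with brackets $[A,A']=AA'-A'A$, $[A,v]=Av$, $[A,s]=A\cdot s$,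 $[v,w]=0$, $[v,s]=0$, $[s,s']=\kappa(s,s')$. Put $\mathfrak{s}_-=V\oplus S$ and $\kappa_s=\kappa(s,s)$. Spencer cohomology. $\mathsf{C}^{d,p}(\mathfrak{s}_-;\mathfrak{s})$ is the space of degree-$d$ (for the $\mathbb{Z}$-grading) maps in $\operatorname{Hom}(\Lambda^p\mathfrak{s}_-,\mathfrak{s})$, with $\Lambda^p$ in the super sense; with the Chevalley–Eilenberg differential $\partial$ of $\mathfrak{s}_-$ with values in $\mathfrak{s}$ (restricted adjoint action), it is a complex in $p$ for each $d$, and $\mathsf{H}^{d,p}(\mathfrak{s}_-;\mathfrak{s})$ is its cohomology, an $\mathfrak{s}_0$-module. A normalised cocycle is a cocycle in $\mathsf{C}^{2,2}$ of the form $\beta+\gamma$ with $\beta\in\operatorname{Hom}(V\otimes S,S)$, $\gamma\in\operatorname{Hom}(\operatorname{Sym}^2S,\mathfrak{so}(V))$ (zero component in $\operatorname{Hom}(\Lambda^2V,V)$); explicitly, $\beta+\gamma$ is a cocycle if and only if $2\kappa(s,\beta(v,s))+\gamma(s,s)v=0$ and $\beta(\kappa_s,s)+\gamma(s,s)\cdot s=0$ for all $s\in S$, $v\in V$. $\mathcal{H}^{2,2}$ denotes the space of normalised cocycles; every class in $\mathsf{H}^{2,2}(\mathfrak{s}_-;\mathfrak{s})$ has a unique normalised representative, so $\mathcal{H}^{2,2}\cong\mathsf{H}^{2,2}(\mathfrak{s}_-;\mathfrak{s})$. *)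

(* Defs.v *)
From HB Require Import structures.
From mathcomp Require Import all_boot all_order all_fingroup all_algebra.
From mathcomp Require Import generic_quotient ring_quotient.
From mathcomp Require Import boolp classical_sets functions reals.
From mathcomp Require Import ring lra.

Set Implicit Arguments.
Unset Strict Implicit.
Unset Printing Implicit Defensive.

Import GRing.Theory.

Local Open Scope ring_scope.
Local Open Scope quotient_scope.

Section QuotientModule.
Variables (K : pzRingType) (M : lmodType K) (W : {pred M}).
Hypothesis Wmod : submod_closed W.

Definition submod_of of submod_closed W := W.
HB.instance Definition _ :=
  GRing.isSubmodClosed.Build K M (submod_of Wmod) Wmod.

Definition lquot := Quotient.quot (submod_of Wmod).
HB.instance Definition _ := GRing.Zmodule.on lquot.
HB.instance Definition _ := EqQuotient.on lquot.

Definition lquot_scale (a : K) (x : lquot) : lquot := \pi_lquot (a *: repr x).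

Lemma eqlquotP (x y : M) : reflect (x = y %[mod lquot]) (x - y \in W).
Proof. by rewrite -[W]/(submod_of Wmod : {pred M}) Quotient.idealrBE; exact: eqP. Qed.

Lemma pi_lquot_scale a : {morph \pi_lquot : x / a *: x >-> lquot_scale a x}.
Proof.
move=> x; apply/eqlquotP; rewrite -scalerBr -[_ *: _]addr0.
by apply: Wmod.2 (Wmod.1); apply/eqlquotP; rewrite reprK.
Qed.

Lemma pi_lquotD : {morph \pi_lquot : x y / x + y >-> x + y}.
Proof. by move=> x y; exact: Quotient.pi_add. Qed.

Let scaleA a b (x : lquot) :
  lquot_scale a (lquot_scale b x) = lquot_scale (a * b) x.
Proof. by rewrite -[x]reprK -(pi_lquot_scale b) -2!pi_lquot_scale scalerA. Qed.

Let scale1 : left_id 1 lquot_scale.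
Proof. by move=> x; rewrite -[x]reprK -pi_lquot_scale scale1r. Qed.

Let scaleDr : right_distributive lquot_scale +%R.
Proof.
by move=> a x y; rewrite -[x]reprK -[y]reprK -pi_lquotD -!pi_lquot_scale -pi_lquotD scalerDr.
Qed.

Let scaleDl (x : lquot) : {morph lquot_scale^~ x : a b / a + b}.
Proof.
by move=> a b; rewrite -[x]reprK -!pi_lquot_scale -pi_lquotD scalerDl.
Qed.

HB.instance Definition _ :=
  GRing.Zmodule_isLmodule.Build K lquot scaleA scale1 scaleDr scaleDl.

Lemma pi_lquot_linear : linear \pi_lquot.
Proof. by move=> a x y; rewrite pi_lquotD pi_lquot_scale. Qed.

End QuotientModule.

(* [Sig11] is the signature (1,1), where the index [mu : 'I_2] is that of the
   basis [e_0, e_1]; [Sig02] is the positive definite "signature (0,2)", where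
   the indices [0, 1 : 'I_2] stand for the basis [e_1, e_2]. *)
Inductive signature := Sig11 | Sig02.

(* The symmetric (sign +1) and the skew (sign -1) admissible bilinear form. *)
Inductive admissible := Bsym | Bskew.

Section Clifford.
Variable R : realType.

Definition mx2 (a b c d : R) : 'M[R]_2 :=
  \matrix_(i, j) if i == 0 then (if j == 0 then a else b)
                 else (if j == 0 then c else d).

Definition sigma1 : 'M[R]_2 := mx2 0 1 1 0.
Definition sigma3 : 'M[R]_2 := mx2 1 0 0 (-1).
Definition Omega : 'M[R]_2 := mx2 0 1 (-1) 0.

Variable t : signature.

Definition etamx : 'M[R]_2 :=
  match t with Sig11 => mx2 (-1) 0 0 1 | Sig02 => 1%:M end.

Definition eta_form (v w : 'cV[R]_2) : R := (v^T *m etamx *m w) 0 0.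

Definition e_ (mu : 'I_2) : 'cV[R]_2 := delta_mx mu 0.

Definition Gamma (mu : 'I_2) : 'M[R]_2 :=
  match t with
  | Sig11 => if mu == 0 then Omega else sigma1
  | Sig02 => if mu == 0 then sigma3 else sigma1
  end.

Definition Gamma_star : 'M[R]_2 := Gamma 0 *m Gamma 1.

Definition cliff (v : 'cV[R]_2) (s : 'cV[R]_2) : 'cV[R]_2 :=
  \sum_mu v mu 0 *: (Gamma mu *m s).

Definition Gamma_up (mu : 'I_2) : 'M[R]_2 :=
  \sum_nu invmx etamx mu nu *: Gamma nu.

Definition Gamma_up2 (mu nu : 'I_2) : 'M[R]_2 :=
  2^-1 *: (Gamma_up mu *m Gamma_up nu - Gamma_up nu *m Gamma_up mu).

Definition eps (mu nu : 'I_2) : R := (mu < nu)%N%:R - (nu < mu)%N%:R.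

Definition Bmx (b : admissible) : 'M[R]_2 :=
  match b, t with
  | Bsym, Sig11 => sigma1
  | Bsym, Sig02 => 1%:M
  | Bskew, _ => Omega
  end.

Definition Bform (b : admissible) (s s' : 'cV[R]_2) : R :=
  (s^T *m Bmx b *m s') 0 0.

Definition so_pred : {pred 'M[R]_2} :=
  [pred A | A^T *m etamx + etamx *m A == 0].

Lemma so_submod : submod_closed so_pred.
Proof.
split=> [|a A B]; first by rewrite inE trmx0 mul0mx mulmx0 addr0.
rewrite !inE => /eqP hA /eqP hB; apply/eqP.
rewrite linearP mulmxDl mulmxDr -scalemxAl -scalemxAr addrACA -scalerDr hA hB.
by rewrite scaler0 addr0.
Qed.
HB.instance Definition _ := GRing.isSubmodClosed.Build R _ so_pred so_submod.

Record so := So { so_mx :> 'M[R]_2; so_mxP : so_mx \in so_pred }.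
HB.instance Definition _ := [isSub for so_mx].
HB.instance Definition _ := [Choice of so by <:].
HB.instance Definition _ := [SubChoice_isSubLmodule of so by <:].

Lemma so_br_subproof (A B : so) : (A *m B - B *m A : 'M[R]_2) \in so_pred.
Proof.
have E (C : so) : C^T *m etamx = - (etamx *m C).
  by apply/eqP; rewrite -subr_eq0 opprK; exact: so_mxP.
rewrite inE linearB /= !trmx_mul mulmxBl mulmxBr -!mulmxA !E !mulmxN !mulmxA.
by rewrite !E !mulNmx !opprK addrC addrA subrK subrr.
Qed.

Definition so_br (A B : so) : so := So (so_br_subproof A B).

(* [A] acts on the pinor module by [1/4 A_(mu nu) Gamma^(mu nu)]. *)
Definition spin (A : so) : 'M[R]_2 :=
  4^-1 *: \sum_mu \sum_nu eta_form (e_ mu) (A *m e_ nu) *: Gamma_up2 mu nu.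

Record so_rep := SoRep {
  rep_sort :> lmodType R;
  rep_act : so -> rep_sort -> rep_sort;
  rep_linearl : forall s, linear (rep_act^~ s);
  rep_linearr : forall A, linear (rep_act A);
  rep_br : forall A B s,
    rep_act (so_br A B) s = rep_act A (rep_act B s) - rep_act B (rep_act A s)
}.

Record dirac_current (S : so_rep) := DiracCurrent {
  dirac :> S -> S -> 'cV[R]_2;
  dirac_linear : forall s, linear (dirac s);
  dirac_sym : forall s s', dirac s s' = dirac s' s;
  dirac_equiv : forall (A : so) s s',
    so_mx A *m dirac s s' = dirac (rep_act A s) s' + dirac s (rep_act A s')
}.

End Clifford.

Arguments so R t : clear implicits.
Arguments rep_act {R t} s0.

Section Pinor.
Variable R : realType.

Lemma ord2E (i : 'I_2) : i = if i == 0 then 0 else 1.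
Proof. by case: i => [[|[|//]] ?]; apply/val_inj. Qed.

Lemma mx2E (A : 'M[R]_2) : A = mx2 (A 0 0) (A 0 1) (A 1 0) (A 1 1).
Proof.
by apply/matrixP=> i j; rewrite (ord2E i) (ord2E j) mxE; do 2 case: (_ == 0).
Qed.

Lemma sum2 (M : nmodType) (F : 'I_2 -> M) : \sum_i F i = F 0 + F 1.
Proof. by rewrite big_ord_recl big_ord1; congr (_ + F _); apply/val_inj. Qed.

Lemma mul_mx2 a b c d a' b' c' d' : mx2 a b c d *m mx2 a' b' c' d' =
  mx2 (a * a' + b * c') (a * b' + b * d') (c * a' + d * c') (c * b' + d * d')
  :> 'M[R]_2.
Proof. by rewrite [LHS]mx2E !mxE !sum2 !mxE. Qed.

Lemma add_mx2 a b c d a' b' c' d' : mx2 a b c d + mx2 a' b' c' d' =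
  mx2 (a + a') (b + b') (c + c') (d + d') :> 'M[R]_2.
Proof. by rewrite [LHS]mx2E !mxE. Qed.

Lemma opp_mx2 a b c d : - mx2 a b c d = mx2 (- a) (- b) (- c) (- d) :> 'M[R]_2.
Proof. by rewrite [LHS]mx2E !mxE. Qed.

Lemma scale_mx2 k a b c d :
  k *: mx2 a b c d = mx2 (k * a) (k * b) (k * c) (k * d) :> 'M[R]_2.
Proof. by rewrite [LHS]mx2E !mxE. Qed.

Lemma tr_mx2 a b c d : (mx2 a b c d)^T = mx2 a c b d :> 'M[R]_2.
Proof. by rewrite [LHS]mx2E !mxE. Qed.

Lemma one_mx2 : 1%:M = mx2 1 0 0 1 :> 'M[R]_2.
Proof. by rewrite [LHS]mx2E !mxE. Qed.

Definition mxE2 := (mul_mx2, add_mx2, opp_mx2, scale_mx2, tr_mx2, one_mx2).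

Lemma etamx_invol t : etamx R t *m etamx R t = 1%:M.
Proof. by case: t; rewrite /= ?mxE2; congr mx2; ring. Qed.

Lemma invmx_eta t : invmx (etamx R t) = etamx R t.
Proof.
have [U _] := mulmx1_unit (etamx_invol t).
by rewrite -[LHS]mulmx1 -(etamx_invol t) mulKmx.
Qed.

Lemma e_mulmx t (A : 'M[R]_2) mu nu :
  eta_form t (e_ R mu) (A *m e_ R nu) = (etamx R t *m A) mu nu.
Proof.
by rewrite /eta_form /e_ trmx_delta -rowE mulmxA -row_mul -colE !mxE.
Qed.

Lemma eta_gram t mu nu : eta_form t (e_ R mu) (e_ R nu) = etamx R t mu nu.
Proof. by rewrite -[e_ R nu in LHS]mul1mx e_mulmx mulmx1. Qed.

Lemma Gamma_starE t : Gamma_star R t =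
  match t with Sig11 => sigma3 R | Sig02 => Omega R end.
Proof. by case: t; rewrite /Gamma_star /= mxE2; congr mx2; ring. Qed.

Lemma Gamma_up2E t mu nu : Gamma_up2 R t mu nu =
  (etamx R t 0 0 * etamx R t 1 1 * eps R mu nu) *: Gamma_star R t.
Proof.
rewrite /Gamma_up2 /Gamma_up invmx_eta !sum2 Gamma_starE.
case: t; rewrite (ord2E mu) (ord2E nu) /eps;
  case: (mu == 0); case: (nu == 0);
  by rewrite /= !mxE /= !mxE2; congr mx2; field.
Qed.

Lemma Gamma_clifford t mu nu :
  Gamma R t mu *m Gamma R t nu + Gamma R t nu *m Gamma R t mu =
  (2 * etamx R t mu nu)%:M.
Proof.
rewrite -scalemx1; case: t; rewrite (ord2E mu) (ord2E nu);
  case: (mu == 0); case: (nu == 0);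
  by rewrite /= !mxE /= !mxE2; congr mx2; ring.
Qed.

Definition so_gen t : 'M[R]_2 :=
  match t with Sig11 => mx2 0 1 1 0 | Sig02 => mx2 0 1 (-1) 0 end.

Lemma soE t (A : so R t) : so_mx A = so_mx A 0 1 *: so_gen t.
Proof.
have := so_mxP A; rewrite inE [so_mx A]mx2E => /eqP/matrixP h.
move: (h 0 0) (h 0 1) (h 1 1); case: t A {h} => A;
  rewrite /= !mxE2 ?mxE /= => h00 h01 h11;
  congr mx2; lra.
Qed.

Lemma spinE t (A : so R t) : spin A = (so_mx A 0 1 / 2) *: Gamma_star R t.
Proof.
rewrite /spin !sum2 !Gamma_up2E !e_mulmx soE Gamma_starE.
case: t A => A; rewrite /= !mxE !sum2 !mxE /eps /= !mxE2; congr mx2;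
  by field; rewrite ?pnatr_eq0.
Qed.

Definition pinor_act t (A : so R t) (s : 'cV[R]_2) : 'cV[R]_2 := spin A *m s.

Lemma pinor_linearl t s : linear (@pinor_act t ^~ s).
Proof.
move=> a A A'; rewrite /= /pinor_act !spinE -!scalemxAl scalerA.
by rewrite -scalerDl; congr (_ *: _); rewrite !mxE; ring.
Qed.

Lemma pinor_linearr t A : linear (@pinor_act t A).
Proof. by move=> a s s'; rewrite /pinor_act mulmxDr scalemxAr. Qed.

Lemma so_comm t (A B : so R t) : so_br A B = 0.
Proof.
apply/val_inj; rewrite /= (soE A) (soE B) -!scalemxAl -!scalemxAr !scalerA.
by rewrite mulrC subrr.
Qed.

Lemma pinor_br t A B s : @pinor_act t (so_br A B) s =
  pinor_act A (pinor_act B s) - pinor_act B (pinor_act A s).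
Proof.
rewrite so_comm /pinor_act !spinE !mxE mul0r scale0r mul0mx -!scalemxAl.
by rewrite -!scalemxAr !scalerA mulrC subrr.
Qed.

Definition pinor t : so_rep R t :=
  SoRep (@pinor_linearl t) (@pinor_linearr t) (@pinor_br t).

(* The positive half [S_+] of the pinor module in signature (1,1). *)
Definition half_pred : {pred 'cV[R]_2} :=
  [pred s | Gamma_star R Sig11 *m s == s].

Lemma half_submod : submod_closed half_pred.
Proof.
split=> [|a s s']; first by rewrite inE mulmx0.
by rewrite !inE mulmxDr -scalemxAr => /eqP-> /eqP->.
Qed.
HB.instance Definition _ :=
  GRing.isSubmodClosed.Build R _ half_pred half_submod.

Record half := Half { half_val :> 'cV[R]_2; half_valP : half_val \in half_pred }.
HB.instance Definition _ := [isSub for half_val].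
HB.instance Definition _ := [Choice of half by <:].
HB.instance Definition _ := [SubChoice_isSubLmodule of half by <:].

Lemma half_act_subproof (A : so R Sig11) (s : half) :
  pinor_act A s \in half_pred.
Proof.
rewrite inE /pinor_act spinE -scalemxAl -scalemxAr.
by rewrite !(eqP (half_valP s)).
Qed.

Definition half_act (A : so R Sig11) (s : half) : half :=
  Half (half_act_subproof A s).

Lemma half_linearl s : linear (half_act^~ s).
Proof. by move=> a A A'; apply/val_inj; exact: pinor_linearl. Qed.

Lemma half_linearr A : linear (half_act A).
Proof. by move=> a s s'; apply/val_inj; exact: pinor_linearr. Qed.

Lemma half_br A B s : half_act (so_br A B) s =
  half_act A (half_act B s) - half_act B (half_act A s).
Proof. by apply/val_inj; exact: pinor_br. Qed.

Definition half_pinor : so_rep R Sig11 :=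
  SoRep half_linearl half_linearr half_br.

Definition current t b (s s' : 'cV[R]_2) : 'cV[R]_2 :=
  invmx (etamx R t) *m \col_mu Bform t b s (Gamma R t mu *m s').

(* The defining property of the Dirac current, which determines it since
   [eta_form] is non-degenerate. *)
Lemma currentP t b s s' v :
  eta_form t (current t b s s') v = Bform t b s (cliff t v s').
Proof.
rewrite /current /eta_form /cliff invmx_eta trmx_mul.
have -> : (etamx R t)^T = etamx R t by case: t; rewrite /= ?mxE2.
rewrite -[X in X *m v]mulmxA etamx_invol mulmx1.
rewrite /Bform mulmx_sumr summxE mxE; apply: eq_bigr => mu _.
by rewrite -scalemxAr !mxE mulrC.
Qed.

Lemma current_linear t b s : linear (current t b s).
Proof.
move=> a s1 s2; rewrite /current scalemxAr -mulmxDr; congr (_ *m _).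
by apply/matrixP=> i j; rewrite !mxE /Bform mulmxDr -scalemxAr mulmxDr -scalemxAr !mxE.
Qed.

Lemma current_sym t b s s' : current t b s s' = current t b s' s.
Proof.
rewrite /current; congr (_ *m _); apply/matrixP=> i j.
rewrite !mxE /Bform (ord2E i); case: (i == 0); case: b; case: t;
  rewrite /= !(mxE, sum2) /=; ring.
Qed.

Let curmx t b (mu : 'I_2) : 'M[R]_2 :=
  etamx R t mu mu *: (Bmx R t b *m Gamma R t mu).

Let currentE t b s s' mu :
  current t b s s' mu 0 = (s^T *m curmx t b mu *m s') 0 0.
Proof.
rewrite /curmx -scalemxAr -scalemxAl [RHS]mxE !mulmxA.
rewrite /current invmx_eta mxE sum2 [X in _ * X + _]mxE [X in _ + _ * X]mxE.
rewrite /Bform !mulmxA (ord2E mu).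
by case: (mu == 0); case: t; rewrite /= ?[mx2 _ _ _ _ _ _]mxE ?[1%:M _ _]mxE /=; ring.
Qed.

Let curmx_equiv t b mu :
  so_gen t mu 0 *: curmx t b 0 + so_gen t mu 1 *: curmx t b 1 =
  2^-1 *: ((Gamma_star R t)^T *m curmx t b mu + curmx t b mu *m Gamma_star R t).
Proof.
rewrite Gamma_starE /curmx (ord2E mu).
by case: (mu == 0); case: b; case: t;
  rewrite /= !mxE /= !mxE2; congr mx2; field.
Qed.

Lemma current_equiv t b (A : so R t) s s' : so_mx A *m current t b s s' =
  current t b (pinor_act A s) s' + current t b s (pinor_act A s').
Proof.
rewrite /pinor_act !spinE [in LHS](soE A); set a := so_mx A 0 1.
apply/matrixP=> mu j; rewrite (ord1 j) mxE sum2 [RHS]mxE !currentE.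
rewrite ![(_ *: so_gen t) _ _]mxE.
have bilD M N : (s^T *m (M + N) *m s') 0 0 =
    (s^T *m M *m s') 0 0 + (s^T *m N *m s') 0 0.
  by rewrite mulmxDr mulmxDl mxE.
have bilZ k M : (s^T *m (k *: M) *m s') 0 0 = k * (s^T *m M *m s') 0 0.
  by rewrite -scalemxAr -scalemxAl mxE.
have Gl K : (((a / 2 *: Gamma_star R t) *m s)^T *m K *m s') 0 0 =
    a / 2 * (s^T *m ((Gamma_star R t)^T *m K) *m s') 0 0.
  by rewrite -scalemxAl linearZ /= trmx_mul -!scalemxAl mxE !mulmxA.
have Gr K : (s^T *m K *m ((a / 2 *: Gamma_star R t) *m s')) 0 0 =
    a / 2 * (s^T *m (K *m Gamma_star R t) *m s') 0 0.
  by rewrite -scalemxAl -scalemxAr mxE !mulmxA.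
rewrite Gl Gr.
have := congr1 (fun M => (s^T *m M *m s') 0 0) (curmx_equiv t b mu).
rewrite /= bilD !bilZ bilD => /(congr1 ( *%R a)); lra.
Qed.

Definition pinor_current t b : dirac_current (pinor t) :=
  @DiracCurrent R t (pinor t) (current t b) (current_linear t b)
    (current_sym t b) (@current_equiv t b).

End Pinor.

Section FlatModel.
Variables (R : realType) (t : signature) (S : so_rep R t).
Variable kappa : dirac_current S.

(* [s_- = V + S] and [s = V + S + so(V)], with [V] even of degree -2, [S] odd
   of degree -1 and [so(V)] even of degree 0. *)
Definition sneg : Type := ('cV[R]_2 * S)%type.
Definition flat : Type := ('cV[R]_2 * S * so R t)%type.
HB.instance Definition _ := GRing.Lmodule.on sneg.
HB.instance Definition _ := GRing.Lmodule.on flat.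

Definition inneg (x : sneg) : flat := (x, 0).
Definition inso (A : so R t) : flat := (0, A).

Definition br (x y : flat) : flat :=
  (so_mx x.2 *m y.1.1 - so_mx y.2 *m x.1.1 + kappa x.1.2 y.1.2,
   rep_act S x.2 y.1.2 - rep_act S y.2 x.1.2,
   so_br x.2 y.2).

(* [V + S] is an ideal of [s]: the [so(V)]-component of [br] vanishes here. *)
Definition br_neg (x y : sneg) : sneg := (br (inneg x) (inneg y)).1.
Definition so_neg (A : so R t) (x : sneg) : sneg := (br (inso A) (inneg x)).1.

Definition in_deg (k : int) (x : flat) : Prop :=
  [/\ k != - 2 -> x.1.1 = 0, k != - 1 -> x.1.2 = 0 & k != 0 -> x.2 = 0].

(* Projection of [s_-] onto its part of parity [e], of degree [e - 2]. *)
Definition hproj (e : bool) (x : sneg) : sneg :=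
  if e then (0, x.2) else (x.1, 0).

Definition homog (e : bool) (x : sneg) : Prop := hproj e x = x.

Definition upd p (x : 'I_p -> sneg) (i : 'I_p) (y : sneg) : 'I_p -> sneg :=
  fun j => if j == i then y else x j.

(* Linear maps [Lambda^p s_- -> s], as multilinear maps which are alternating
   in the super sense: exchanging two neighbouring homogeneous arguments of
   parities [e] and [e'] multiplies the value by [- (-1) ^ (e e')]. *)
Definition multilinear p (f : ('I_p -> sneg) -> flat) : Prop :=
  forall x i a y z,
    f (upd x i (a *: y + z)) = a *: f (upd x i y) + f (upd x i z).

Definition superalt p (f : ('I_p -> sneg) -> flat) : Prop :=
  forall (e : 'I_p -> bool) (x : 'I_p -> sneg) (i j : 'I_p),
    (forall k, homog (e k) (x k)) -> j = i.+1 :> nat ->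
    f (x \o tperm i j) = - ((-1) ^+ (e i && e j) *: f x).

Definition has_degree (d : int) p (f : ('I_p -> sneg) -> flat) : Prop :=
  forall (e : 'I_p -> bool) (x : 'I_p -> sneg),
    (forall k, homog (e k) (x k)) ->
    in_deg (d + \sum_k ((e k : nat)%:Z - 2)) (f x).

Definition is_cochain d p (f : ('I_p -> sneg) -> flat) : Prop :=
  [/\ multilinear f, superalt f & has_degree d f].

(* The Chevalley-Eilenberg differential of a [p]-cochain of degree [d] (hence
   of the parity of [d]), evaluated at homogeneous [x 0, .., x p] of parities
   [e 0, .., e p].  In the second sum, [x i] is moved next to [x j], and the
   two are replaced by [[x i, x j]] at the place of [x j]; bringing the bracket
   to the front turns the sign into the more usual
   [(-1) ^ (i + j)] times the Koszul sign. *)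
Definition ce_homog (d : int) p (f : ('I_p -> sneg) -> flat)
    (e : 'I_p.+1 -> bool) (x : 'I_p.+1 -> sneg) : flat :=
  (\sum_(i < p.+1)
     (-1) ^+ (i + e i * (`|d| + \sum_(k < p.+1 | k < i) e k))%N *:
       br (inneg (x i)) (f (x \o lift i)))
  + \sum_(i < p.+1) \sum_(j < p.+1 | (i < j)%N)
      (-1) ^+ (i.+1 + e i * \sum_(k < p.+1 | i < k < j) e k)%N *:
        f (upd x j (br_neg (x i) (x j)) \o lift i).

Definition ce d p (f : ('I_p -> sneg) -> flat) (x : 'I_p.+1 -> sneg) : flat :=
  \sum_(e : {ffun 'I_p.+1 -> bool})
    ce_homog d f e (fun i => hproj (e i) (x i)).

Definition so_hom p (A : so R t) (f : ('I_p -> sneg) -> flat)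
    (x : 'I_p -> sneg) : flat :=
  br (inso A) (f x) - \sum_i f (upd x i (so_neg A (x i))).

Definition cochain_pred d p : {pred ('I_p -> sneg) -> flat} :=
  [pred f | `[< is_cochain d f >]].

Lemma cochain_submod d p : submod_closed (@cochain_pred d p).
Proof.
split.
  rewrite inE; split.
  - by move=> x i a y z; rewrite scaler0 addr0.
  - by move=> e x i j _ _; rewrite scaler0 oppr0.
  - by move=> e x _; split.
move=> a f g; rewrite !inE => -[f1 f2 f3] [g1 g2 g3].
split.
- move=> x i b y z; rewrite !fctE.
  rewrite f1 g1 !scalerDr !scalerA mulrC -!addrA; congr (_ + _).
  by rewrite addrCA.
- move=> e x i j ex ij; rewrite !fctE (f2 e) // (g2 e) //.
  by rewrite scalerDr opprD scalerN !scalerA mulrC.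
- move=> e x ex; have [u1 u2 u3] := f3 e x ex; have [v1 v2 v3] := g3 e x ex.
  split=> h; rewrite !fctE /=.
  + by rewrite u1 // v1 // scaler0 addr0.
  + by rewrite u2 // v2 // scaler0 addr0.
  + by rewrite u3 // v3 // scaler0 addr0.
Qed.
HB.instance Definition _ d p :=
  GRing.isSubmodClosed.Build R _ (@cochain_pred d p) (cochain_submod d p).

Record cochain d p := Cochain {
  cochain_val :> ('I_p -> sneg) -> flat;
  cochain_valP : cochain_val \in @cochain_pred d p
}.
HB.instance Definition _ d p := [isSub for @cochain_val d p].
HB.instance Definition _ d p := [Choice of cochain d p by <:].
HB.instance Definition _ d p := [SubChoice_isSubLmodule of cochain d p by <:].

Lemma linearP0 (U W : lmodType R) (f : U -> W) : linear f -> f 0 = 0.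
Proof.
move=> lf; have := lf 1 0 0; rewrite scaler0 addr0 scale1r => /eqP.
by rewrite -subr_eq0 opprD addrA subrr add0r oppr_eq0 => /eqP.
Qed.

Lemma linearPD (U W : lmodType R) (f : U -> W) :
  linear f -> {morph f : x y / x + y}.
Proof. by move=> lf x y; have := lf 1 x y; rewrite !scale1r. Qed.

Lemma linearPZ (U W : lmodType R) (f : U -> W) :
  linear f -> forall a, {morph f : x / a *: x}.
Proof.
by move=> lf a x; have := lf a x 0; rewrite (linearP0 lf) !addr0.
Qed.

Lemma linearPB (U W : lmodType R) (f : U -> W) :
  linear f -> {morph f : x y / x - y}.
Proof.
by move=> lf x y; rewrite (linearPD lf) -scaleN1r (linearPZ lf) scaleN1r.
Qed.

Lemma linearPsum (U W : lmodType R) (f : U -> W) : linear f ->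
  forall I (r : seq I) P (F : I -> U),
  f (\sum_(i <- r | P i) F i) = \sum_(i <- r | P i) f (F i).
Proof.
move=> lf I r P F; apply: (big_morph f); first exact: linearPD.
exact: linearP0.
Qed.

Lemma br_linearr x : linear (br x).
Proof.
move=> a y z; rewrite /br; congr (_, _, _) => /=.
- rewrite mulmxDr -scalemxAr mulmxDl -scalemxAl (dirac_linear kappa).
  rewrite !scalerDr scalerN opprD -!addrA; congr (_ + _).
  rewrite !addrA addrC; apply/eqP; rewrite -subr_eq0; apply/eqP.
  apply/matrixP=> i j; rewrite !mxE; ring.
- rewrite rep_linearr rep_linearl !scalerDr scalerN opprD -!addrA.
  by congr (_ + _); rewrite addrCA.
- by rewrite !so_comm scaler0 addr0.
Qed.

Lemma br_linearl y : linear (br ^~ y).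
Proof.
move=> a x z; rewrite /br; congr (_, _, _) => /=.
- rewrite mulmxDr -scalemxAr mulmxDl -scalemxAl !(dirac_sym kappa _ y.1.2).
  rewrite (dirac_linear kappa); apply/matrixP=> i j; rewrite !mxE; ring.
- rewrite rep_linearr rep_linearl !scalerDr scalerN opprD -!addrA.
  by congr (_ + _); rewrite addrCA.
- by rewrite !so_comm scaler0 addr0.
Qed.

Lemma kappa0r s : kappa s 0 = 0.
Proof. exact: linearP0 (dirac_linear kappa s). Qed.

Lemma kappa0l s : kappa 0 s = 0.
Proof. by rewrite dirac_sym kappa0r. Qed.

Lemma rep_act0r A : rep_act S A 0 = 0.
Proof. exact: linearP0 (rep_linearr A). Qed.

Lemma rep_act0l s : rep_act S 0 s = 0.
Proof. exact: linearP0 (@rep_linearl _ _ S s). Qed.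

Lemma br_so A x : br (inso A) x =
  (so_mx A *m x.1.1, rep_act S A x.1.2, so_br A x.2).
Proof.
by rewrite /br /= mulmx0 subr0 kappa0l addr0 rep_act0r subr0.
Qed.

Lemma so_negE A x : so_neg A x = (so_mx A *m x.1, rep_act S A x.2).
Proof. by rewrite /so_neg br_so. Qed.

Lemma so_neg_linear A : linear (so_neg A).
Proof.
move=> a x y; rewrite !so_negE /= mulmxDr -scalemxAr (rep_linearr A).
by [].
Qed.

Lemma so_neg_hproj A e x : so_neg A (hproj e x) = hproj e (so_neg A x).
Proof. by rewrite !so_negE; case: e; rewrite /= ?mulmx0 ?rep_act0r. Qed.

Lemma so_neg_homog A e x : homog e x -> homog e (so_neg A x).
Proof. by rewrite /homog -so_neg_hproj => ->. Qed.

Lemma inneg_so A x : inneg (so_neg A x) = br (inso A) (inneg x).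
Proof. by rewrite so_negE br_so /= so_comm. Qed.

Lemma br_deriv A x y : br (inso A) (br x y) =
  br (br (inso A) x) y + br x (br (inso A) y).
Proof.
rewrite !(br_so A) /br; congr (_, _, _) => /=.
- rewrite mulmxDr mulmxBr !mulmxBl !mulmxA dirac_equiv.
  by apply/matrixP=> i j; rewrite !mxE; ring.
- rewrite (linearPB (rep_linearr A)) !rep_br opprB.
  set a := rep_act _ A (rep_act _ x.2 _); set b := rep_act _ A (rep_act _ y.2 _).
  set c := rep_act _ x.2 (rep_act _ A _); set f := rep_act _ y.2 (rep_act _ A _).
  by rewrite -(addrA a) -opprD [c + (f - b)]addrA addrA subrK.
- by rewrite !so_comm addr0.
Qed.

Lemma so_neg_br A x y : so_neg A (br_neg x y) =
  br_neg (so_neg A x) y + br_neg x (so_neg A y).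
Proof.
rewrite /br_neg !inneg_so -[RHS]/((_ + _ : flat).1) -br_deriv /so_neg.
by rewrite !br_so.
Qed.

Lemma updE p (x : 'I_p -> sneg) i y : upd x i y i = y.
Proof. by rewrite /upd eqxx. Qed.

Lemma upd_upd p (x : 'I_p -> sneg) i y z : upd (upd x i y) i z = upd x i z.
Proof. by apply/funext => k; rewrite /upd; case: eqP. Qed.

Lemma updC p (x : 'I_p -> sneg) i j y z : i != j ->
  upd (upd x i y) j z = upd (upd x j z) i y.
Proof.
move=> ij; apply/funext => k; rewrite /upd; case: (eqVneq k j) => // ->.
by rewrite eq_sym (negPf ij).
Qed.

Lemma upd_lift p (x : 'I_p.+1 -> sneg) i y : upd x i y \o lift i = x \o lift i.
Proof.
by apply/funext => k; rewrite /upd /= eq_sym (negPf (neq_lift i k)).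
Qed.

Lemma upd_lift_lift p (x : 'I_p.+1 -> sneg) i k y :
  upd x (lift i k) y \o lift i = upd (x \o lift i) k y.
Proof. by apply/funext => l; rewrite /upd /= (inj_eq lift_inj). Qed.

Lemma upd_tperm p (x : 'I_p -> sneg) i j k y :
  upd (x \o tperm i j) k y = upd x (tperm i j k) y \o tperm i j.
Proof. by apply/funext => l; rewrite /upd /= (inj_eq perm_inj). Qed.

Lemma in_degD k (x y : flat) : in_deg k x -> in_deg k y -> in_deg k (x + y).
Proof.
move=> [x1 x2 x3] [y1 y2 y3]; split=> h /=.
- by rewrite x1 // y1 // addr0.
- by rewrite x2 // y2 // addr0.
- by rewrite x3 // y3 // addr0.
Qed.

Lemma in_degB k (x y : flat) : in_deg k x -> in_deg k y -> in_deg k (x - y).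
Proof.
move=> [x1 x2 x3] [y1 y2 y3]; split=> h /=.
- by rewrite x1 // y1 // subr0.
- by rewrite x2 // y2 // subr0.
- by rewrite x3 // y3 // subr0.
Qed.

Lemma so_hom_cochain d p A (f : ('I_p -> sneg) -> flat) :
  is_cochain d f -> is_cochain d (so_hom A f).
Proof.
move=> [f1 f2 f3]; split.
- move=> x i a y z; rewrite /so_hom f1 (linearPD (br_linearr _)).
  rewrite (linearPZ (br_linearr _)) scalerBr addrACA -opprD.
  congr (_ + _); apply: congr1.
  rewrite scaler_sumr -big_split; apply: eq_bigr => k _ /=.
  have [->|ki] := eqVneq k i.
    rewrite !updE !upd_upd (so_neg_linear A) f1.
    by [].
  rewrite !(updC _ _ _ (_ : i != k)) 1?eq_sym //.
  by rewrite f1 /upd (negPf ki).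
- move=> e x i j ex ij; rewrite /so_hom (f2 e) // -!scaleNr.
  rewrite (linearPZ (br_linearr _)) scalerBr.
  congr (_ + _); apply: congr1.
  rewrite scaler_sumr (reindex_inj (@perm_inj _ (tperm i j))).
  apply: eq_bigr => k _; rewrite upd_tperm /= tpermK (f2 e) ?scaleNr //.
  move=> l; rewrite /upd; case: eqP => [->|_] //; exact: so_neg_homog.
- move=> e x ex; have [u1 u2 u3] := f3 e x ex.
  have H k : in_deg (d + \sum_l ((e l : nat)%:Z - 2))
      (f (upd x k (so_neg A (x k)))).
    apply: f3 => l; rewrite /upd; case: eqP => [->|_] //; exact: so_neg_homog.
  have K : in_deg (d + \sum_l ((e l : nat)%:Z - 2)) (br (inso A) (f x)).
    rewrite br_so; split=> h /=.
    + by rewrite u1 // mulmx0.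
    + by rewrite u2 // rep_act0r.
    + exact: so_comm.
  apply: in_degB => //.
  apply: (big_ind (in_deg _)) => [|y z|k _]; [by split|exact: in_degD|exact: H].
Qed.

Lemma ce_linear d p a (f g : ('I_p -> sneg) -> flat) :
  ce d (a *: f + g) = a *: ce d f + ce d g.
Proof.
apply/funext => x; rewrite !fctE /ce scaler_sumr -big_split.
apply: eq_bigr => e _ /=; rewrite /ce_homog scalerDr addrACA.
congr (_ + _); rewrite scaler_sumr -big_split; apply: eq_bigr => i _ /=.
  by rewrite !fctE (br_linearr _) scalerDr !scalerA mulrC.
rewrite scaler_sumr -big_split; apply: eq_bigr => j _ /=.
by rewrite !fctE scalerDr !scalerA mulrC.
Qed.

Lemma ce_homog_so d p A (f : ('I_p -> sneg) -> flat) e x : multilinear f ->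
  ce_homog d (so_hom A f) e x =
  br (inso A) (ce_homog d f e x)
    - \sum_k ce_homog d f e (upd x k (so_neg A (x k))).
Proof.
move=> fl; rewrite /ce_homog (linearPD (br_linearr _)) big_split opprD addrACA.
rewrite !(linearPsum (br_linearr _)) exchange_big [X in _ + (_ - X)]exchange_big.
rewrite -!sumrB /=; congr (_ + _); apply: eq_bigr => i _.
  rewrite (linearPZ (br_linearr _)) -scaler_sumr -scalerBr; congr (_ *: _).
  rewrite /so_hom (linearPB (br_linearr _)) (linearPsum (br_linearr _)).
  rewrite br_deriv (bigD1_ord i) //= updE upd_lift inneg_so.
  rewrite opprD addrACA subrr add0r; congr (_ + _); apply: congr1.
  apply: eq_bigr => k _; rewrite upd_lift_lift.
  by rewrite /upd (negPf (neq_lift i k)).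
rewrite (linearPsum (br_linearr _)) exchange_big /= -sumrB.
apply: eq_bigr => j ij.
rewrite (linearPZ (br_linearr _)) -scaler_sumr -scalerBr; congr (_ *: _).
rewrite /so_hom; congr (_ + _); apply: congr1.
have [j' ->] : exists j', j = lift i j'.
  by case: (unliftP i j) ij => [j' ->|->]; [exists j' | rewrite ltnn].
rewrite upd_lift_lift (bigD1 j') //= [RHS](bigD1_ord i) //= [in RHS](bigD1 j') //=.
rewrite !updE upd_upd so_neg_br.
have flD y k u v : f (upd y k (u + v)) = f (upd y k u) + f (upd y k v).
  by have := fl y k 1 u v; rewrite !scale1r.
have ne k : upd x i (so_neg A (x i)) (lift i k) = x (lift i k).
  by rewrite /upd eq_sym (negPf (neq_lift i k)).
have ne' k : upd x (lift i k) (so_neg A (x (lift i k))) i = x i.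
  by rewrite /upd (negPf (neq_lift i k)).
rewrite flD !upd_lift_lift upd_lift ne ne' upd_upd -addrA; congr (_ + (_ + _)).
apply: eq_bigr => k kj; rewrite ne' !upd_lift_lift updC 1?eq_sym //.
by rewrite /upd (negPf kj) (inj_eq lift_inj) eq_sym (negPf kj).
Qed.

Lemma ce_so d p A (f : ('I_p -> sneg) -> flat) : multilinear f ->
  ce d (so_hom A f) = so_hom A (ce d f).
Proof.
move=> fl; apply/funext => x; rewrite /so_hom /ce.
rewrite (linearPsum (br_linearr _)) exchange_big -sumrB; apply: eq_bigr => e _.
rewrite ce_homog_so //; congr (_ + _); apply: congr1; apply: eq_bigr => k _.
congr ce_homog; apply/funext => l; rewrite /upd.
by case: eqP => [->|_] //; rewrite so_neg_hproj.
Qed.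

Lemma ce0 d p : ce d (0 : ('I_p -> sneg) -> flat) = 0.
Proof. exact: linearP0 (@ce_linear d p). Qed.

Lemma so_hom_linear p A : linear (@so_hom p A).
Proof.
move=> a f g; apply/funext => x; rewrite !fctE /so_hom br_linearr.
rewrite scalerBr addrACA -opprD; congr (_ + _); apply: congr1.
by rewrite scaler_sumr -big_split.
Qed.

Lemma cochainP d p (c : cochain d p) : is_cochain d c.
Proof. by have := cochain_valP c; rewrite inE. Qed.

Definition cocycle_pred d p : {pred cochain d p} :=
  [pred c : cochain d p | `[< ce d c = 0 >]].

Lemma cocycle_submod d p : submod_closed (@cocycle_pred d p).
Proof.
split=> [|a c c']; first by rewrite !inE ce0.
by rewrite !inE => c0 c'0; rewrite [LHS]ce_linear c0 c'0 scaler0 addr0.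
Qed.
HB.instance Definition _ d p :=
  GRing.isSubmodClosed.Build R _ (@cocycle_pred d p) (cocycle_submod d p).

Record cocycle d p := Cocycle {
  cocycle_val :> cochain d p;
  cocycle_valP : cocycle_val \in @cocycle_pred d p
}.
HB.instance Definition _ d p := [isSub for @cocycle_val d p].
HB.instance Definition _ d p := [Choice of cocycle d p by <:].
HB.instance Definition _ d p := [SubChoice_isSubLmodule of cocycle d p by <:].

Definition is_coboundary d p : (('I_p -> sneg) -> flat) -> Prop :=
  match p with
  | 0 => fun f => f = 0
  | q.+1 => fun f => exists b : cochain d q, ce d b = f
  end.

Definition coboundary_pred d p : {pred cocycle d p} :=
  [pred c : cocycle d p | `[< is_coboundary d c >]].

Lemma coboundary_submod d p : submod_closed (@coboundary_pred d p).
Proof.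
case: p => [|p]; split=> [|a c c']; rewrite !inE //=.
- move=> c0 c'0; transitivity (a *: cochain_val c + cochain_val c') => //.
  by rewrite c0 c'0 scaler0 addr0.
- by exists 0; rewrite ce0.
- by move=> [b bc] [b' bc']; exists (a *: b + b'); rewrite [LHS]ce_linear bc bc'.
Qed.

(* [H^{d,p}(s_-; s)]: the cocycles in [C^{d,p}] modulo the image of
   [C^{d,p-1}]. *)
Definition spencer d p := lquot (coboundary_submod d p).

Lemma so_cochain_subproof d p A (c : cochain d p) :
  so_hom A c \in @cochain_pred d p.
Proof. by rewrite inE; exact/so_hom_cochain/cochainP. Qed.

Definition so_cochain d p A (c : cochain d p) : cochain d p :=
  Cochain (so_cochain_subproof A c).

Lemma so_cocycle_subproof d p A (c : cocycle d p) :
  so_cochain A c \in @cocycle_pred d p.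
Proof.
have c0 := cocycle_valP c; rewrite !inE /= in c0 *.
have [cl _ _] := cochainP c.
by rewrite ce_so // c0; exact: linearP0 (@so_hom_linear _ A).
Qed.

Definition so_cocycle d p A (c : cocycle d p) : cocycle d p :=
  Cocycle (so_cocycle_subproof A c).

Lemma so_coboundary d p A (f : ('I_p -> sneg) -> flat) :
  is_coboundary d f -> is_coboundary d (so_hom A f).
Proof.
case: p f => [|p] f /=; first by move=> ->; exact: linearP0 (@so_hom_linear _ A).
move=> [b <-]; exists (so_cochain A b); have [bl _ _] := cochainP b.
by rewrite /= ce_so.
Qed.

Definition so_spencer d p A (h : spencer d p) : spencer d p :=
  \pi_(spencer d p) (so_cocycle A (repr h)).

Lemma so_spencerE d p A (c : cocycle d p) :
  so_spencer A (\pi_(spencer d p) c) = \pi_(spencer d p) (so_cocycle A c).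
Proof.
apply/(eqlquotP (coboundary_submod d p)); set c' := repr _.
have : c' - c \in @coboundary_pred d p.
  by apply/(eqlquotP (coboundary_submod d p)); exact: reprK.
rewrite !inE => /(so_coboundary A).
by rewrite [so_hom A _](linearPB (@so_hom_linear p A)).
Qed.

Lemma so_spencer_linear d p A : linear (@so_spencer d p A).
Proof.
have pl := pi_lquot_linear (coboundary_submod d p).
move=> a g h; rewrite -[g]reprK -[h]reprK -pl !so_spencerE -pl.
by congr \pi_(_); do 2 apply/val_inj; exact: so_hom_linear.
Qed.

Definition args2 (x y : sneg) : 'I_2 -> sneg := fun i => if i == 0 then x else y.

(* The components of a cochain in [C^{2,2}] in [Hom (Lambda^2 V, V)],
   [Hom (V * S, S)] and [Hom (Sym^2 S, so V)]. *)
Definition alpha (f : cochain 2 2) (v w : 'cV[R]_2) : 'cV[R]_2 :=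
  (f (args2 (v, 0) (w, 0))).1.1.

Definition beta (f : cochain 2 2) (v : 'cV[R]_2) (s : S) : S :=
  (f (args2 (v, 0) (0, s))).1.2.

Definition gamma (f : cochain 2 2) (s s' : S) : so R t :=
  (f (args2 (0, s) (0, s'))).2.

Definition normalised_cocycle (f : cochain 2 2) : Prop :=
  ce 2 f = 0 /\ forall v w, alpha f v w = 0.

End FlatModel.

Arguments sneg {R t} S.
Arguments flat {R t} S.
Arguments cochain {R t} S d%_ring_scope p%_nat_scope.
Arguments normalised_cocycle {R t S} kappa f.
Arguments cocycle {R t S} kappa d%_ring_scope p%_nat_scope.
Arguments spencer {R t S} kappa d%_ring_scope p%_nat_scope.

Definition nontrivial (R : realType) t (S : so_rep R t)
    (kappa : dirac_current S) : Prop :=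
  exists s s', kappa s s' != 0.

Definition explicit_cocycle (R : realType) (t : signature) (b : admissible)
    (c : R) (f : cochain (pinor R t) 2 2) : Prop :=
  [/\ forall v w, alpha f v w = 0,
      forall mu s, beta f (e_ R mu) s =
        match b with
        | Bsym => c *: (\sum_nu eps R mu nu *: Gamma_up R t nu) *m s
        | Bskew => c *: Gamma R t mu *m s
        end
    & forall s mu nu, eta_form t (e_ R mu) (gamma f s s *m e_ R nu) =
        match b with
        | Bsym => 2 * c * eps R mu nu * Bform t b s s
        | Bskew => - 2 * c * eps R mu nu * Bform t b s (Gamma_star R t *m s)
        end].

(* Main.v *)
(* A 2-cochain of degree 2 is determined by its components alpha, beta, gamma, and
   polarising the two cocycle conditions expresses closedness through them.  A
   1-cochain of degree 2 is a linear map l : V -> so(V), and its coboundary has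
   alpha-component l_v w - l_w v; since dim V = 2 and so(V) is a line, every alpha
   arises from such an l, so every cocycle is a normalised one plus a coboundary.
   For the normalised cocycles, the condition on V * S * S alone is a linear system
   in the coefficients of beta and gamma whose solutions form a line (and vanish for
   S_+); the condition on S * S * S is then automatic.
   A coboundary changes beta only by multiples of Gamma_star, so the trace of beta
   against a suitable Gamma_mu is a linear form on cocycles which vanishes on
   coboundaries and reads off the parameter b: it is the isomorphism with R. *)

Require Import Defs.
From HB Require Import structures.
From mathcomp Require Import all_boot all_order all_fingroup all_algebra.
From mathcomp Require Import generic_quotient.
From mathcomp Require Import boolp classical_sets functions reals.
From mathcomp Require Import ring lra.

Set Implicit Arguments.
Unset Strict Implicit.
Unset Printing Implicit Defensive.

Import GRing.Theory.

Local Open Scope ring_scope.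

(** * Sums and case analysis over two or three indices and over parity patterns *)

Lemma sum3 (M : nmodType) (F : 'I_3 -> M) : \sum_i F i = F 0 + F 1 + F 2.
Proof.
rewrite big_ord_recl sum2 addrA.
by congr (_ + F _ + F _); apply/val_inj.
Qed.

Lemma ord3P (P : 'I_3 -> Prop) : P 0 -> P 1 -> P 2 -> forall i, P i.
Proof.
move=> P0 P1 P2 [[|[|[|//]]] hi].
- by rewrite (_ : Ordinal hi = 0) //; apply/val_inj.
- by rewrite (_ : Ordinal hi = 1) //; apply/val_inj.
- by rewrite (_ : Ordinal hi = 2) //; apply/val_inj.
Qed.

Lemma ord2P (P : 'I_2 -> Prop) : P 0 -> P 1 -> forall i, P i.
Proof. by move=> P0 P1 i; rewrite (ord2E i); case: ifP. Qed.

(** These are the four parity patterns of two arguments, over which [ce] sums when it is applied to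
    a 1-cochain. *)
Lemma sum_ffun2 (M : nmodType) (F : {ffun 'I_2 -> bool} -> M) :
  \sum_e F e = F [ffun=> true] + F [ffun i => i == 1]
    + (F [ffun i => i == 0] + F [ffun=> false]).
Proof.
pose h (p : bool * bool) : {ffun 'I_2 -> bool} :=
  [ffun i => if i == 0 then p.2 else p.1].
pose h' (e : {ffun 'I_2 -> bool}) := (e 1, e 0).
rewrite (reindex h); last first.
  exists h' => [[a b] _|e _]; first by rewrite /h' /h !ffunE.
  by apply/ffunP; apply: ord2P; rewrite !ffunE.
rewrite -(pair_big xpredT xpredT (fun a b => F (h (a, b)))) /=.
rewrite !big_bool /=; congr (_ + _ + (_ + _)); congr F;
  by apply/ffunP; apply: ord2P; rewrite !ffunE.
Qed.

Lemma sum3c (M : nmodType) (P : pred 'I_3) (F : 'I_3 -> M) : \sum_(i | P i) F i =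
  (if P 0 then F 0 else 0) + (if P 1 then F 1 else 0) + (if P 2 then F 2 else 0).
Proof. by rewrite big_mkcond sum3. Qed.

Lemma sum2c (M : nmodType) (P : pred 'I_2) (F : 'I_2 -> M) :
  \sum_(i | P i) F i = (if P 0 then F 0 else 0) + (if P 1 then F 1 else 0).
Proof. by rewrite big_mkcond sum2. Qed.

Lemma lift3 : ((lift (0 : 'I_3) (0 : 'I_2) = 1) * (lift (0 : 'I_3) (1 : 'I_2) = 2)
  * (lift (1 : 'I_3) (0 : 'I_2) = 0) * (lift (1 : 'I_3) (1 : 'I_2) = 2)
  * (lift (2 : 'I_3) (0 : 'I_2) = 0) * (lift (2 : 'I_3) (1 : 'I_2) = 1))%type.
Proof. by do !split; apply/val_inj. Qed.

(** * Entries of matrices, column vectors and bilinear forms in dimension two *)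

Section Entries.
Variable R : realType.
Implicit Type s : 'cV[R]_2.

Lemma mx2_entry (a b c d : R) : (mx2 a b c d 0 0 = a) * (mx2 a b c d 0 1 = b)
  * (mx2 a b c d 1 0 = c) * (mx2 a b c d 1 1 = d).
Proof. by rewrite !mxE. Qed.

Lemma e_entry : (e_ R 0 0 0 = 1) * (e_ R 0 1 0 = 0)
  * (e_ R 1 0 0 = 0) * (e_ R 1 1 0 = 1).
Proof. by rewrite !mxE. Qed.

Lemma mulmx2_entry (M : 'M[R]_2) s i :
  (M *m s) i 0 = M i 0 * s 0 0 + M i 1 * s 1 0.
Proof. by rewrite mxE sum2. Qed.

Lemma form2_entry (M : 'M[R]_2) s s' : (s^T *m M *m s') 0 0 =
  s 0 0 * M 0 0 * s' 0 0 + s 1 0 * M 1 0 * s' 0 0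
  + (s 0 0 * M 0 1 * s' 1 0 + s 1 0 * M 1 1 * s' 1 0).
Proof. by rewrite !mxE !sum2 !mxE !sum2 !mxE !mulrDl. Qed.

Lemma addmx_entry p q (M N : 'M[R]_(p, q)) i j : (M + N) i j = M i j + N i j.
Proof. by rewrite mxE. Qed.

Lemma scalemx_entry p q a (M : 'M[R]_(p, q)) i j : (a *: M) i j = a * M i j.
Proof. by rewrite mxE. Qed.

Lemma zeromx_entry p q i j : (0 : 'M[R]_(p, q)) i j = 0.
Proof. by rewrite mxE. Qed.

Lemma eps_entry : (eps R 0 0 = 0) * (eps R 0 1 = 1)
  * (eps R 1 0 = -1) * (eps R 1 1 = 0).
Proof. by rewrite /eps /= !subr0 sub0r. Qed.
End Entries.

(** * The space of 2-cochains of degree 2 and its cocycle conditions *)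

Section Cochains.
Variables (R : realType) (t : signature) (S : so_rep R t).
Variable kappa : dirac_current S.
Implicit Types (x y z : sneg S) (v w : 'cV[R]_2) (s : S).

Lemma args2E (T : Type) (F : ('I_2 -> sneg S) -> T) (u : 'I_2 -> sneg S) :
  F u = F (args2 (u 0) (u 1)).
Proof. by congr F; apply/funext; apply: ord2P. Qed.

Lemma lin_inV a v v' : ((a *: v + v', 0) : sneg S) = a *: (v, 0) + (v', 0).
Proof. by congr (_, _); rewrite /= scaler0 addr0. Qed.

Lemma lin_inS a s s' : ((0, a *: s + s') : sneg S) = a *: (0, s) + (0, s').
Proof. by congr (_, _); rewrite /= scaler0 addr0. Qed.

Lemma flatP (a b : flat S) :
  a.1.1 = b.1.1 -> a.1.2 = b.1.2 -> a.2 = b.2 -> a = b.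
Proof. by case: a b => [[? ?] ?] [[? ?] ?] /= -> -> ->. Qed.

Lemma kappaNr s s' : kappa s (- s') = - kappa s s'.
Proof. by rewrite -scaleN1r (Defs.linearPZ (dirac_linear kappa s)) scaleN1r. Qed.

Section TwoCochain.
Variable f : cochain S 2 2.

Lemma cochain2_linearl y : linear (fun x => f (args2 x y)).
Proof.
have [fl _ _] := cochainP f; move=> a x z /=.
have U u : args2 u y = upd (args2 0 y) 0 u by apply/funext; apply: ord2P.
by rewrite (U (a *: x + z)) (U x) (U z) fl.
Qed.

Lemma cochain2_linearr x : linear (fun y => f (args2 x y)).
Proof.
have [fl _ _] := cochainP f; move=> a y z /=.
have U u : args2 x u = upd (args2 x 0) 1 u by apply/funext; apply: ord2P.
by rewrite (U (a *: y + z)) (U y) (U z) fl.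
Qed.

Lemma cochain2_swap (e e' : bool) x y : homog e x -> homog e' y ->
  f (args2 y x) = - ((-1) ^+ (e && e') *: f (args2 x y)).
Proof.
have [_ fa _] := cochainP f; move=> ex ey.
rewrite -(fa (fun i => if i == 0 then e else e') _ 0 1) //; last first.
  by apply: ord2P.
by congr (cochain_val f); apply/funext; apply: ord2P; rewrite /= ?tpermL ?tpermR.
Qed.

Lemma cochain2_deg (e e' : bool) x y : homog e x -> homog e' y ->
  in_deg ((e : nat)%:Z + (e' : nat)%:Z - 2) (f (args2 x y)).
Proof.
have [_ _ fd] := cochainP f; move=> ex ey.
have := fd (fun i => if i == 0 then e else e') (args2 x y).
rewrite sum2 /= => /(_ (ord2P _ _)) h.
by rewrite (_ : _ - 2 = 2 + (e%:Z - 2 + (e'%:Z - 2))); [exact: h|ring].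
Qed.

Lemma homogV v : homog false ((v, 0) : sneg S). Proof. by []. Qed.
Lemma homogS s : homog true ((0, s) : sneg S). Proof. by []. Qed.

(** Degree 2 leaves room for only one component of the value on each homogeneous pair: [V] on V * V,
    [S] on V * S, [so(V)] on S * S. The value on S * V is minus the one on V * S, since exchanging
    an even and an odd argument carries no Koszul sign. *)
Lemma cochain2E x y : f (args2 x y) =
  (alpha f x.1 y.1, beta f x.1 y.2 - beta f y.1 x.2, gamma f x.2 y.2).
Proof.
have D z : z = (z.1, 0) + (0, z.2).
  by case: z => z1 z2; congr (_, _); rewrite /= ?addr0 ?add0r.
rewrite [in LHS](D x) (linearPD (cochain2_linearl _)) [in LHS](D y).
rewrite !(linearPD (cochain2_linearr _)).
rewrite [f (args2 (0, x.2) (y.1, 0))]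
  (@cochain2_swap false true (y.1, 0) (0, x.2)) // scale1r.
have [_ a2 a3] := cochain2_deg (homogV x.1) (homogV y.1).
have [b1 _ b3] := cochain2_deg (homogV x.1) (homogS y.2).
have [c1 _ c3] := cochain2_deg (homogV y.1) (homogS x.2).
have [d1 d2 _] := cochain2_deg (homogS x.2) (homogS y.2).
rewrite /alpha /beta /gamma; congr (_, _, _) => /=.
- by rewrite b1 // c1 // d1 // oppr0 !addr0.
- by rewrite a2 // d2 // add0r addr0.
- by rewrite a3 // b3 // c3 // oppr0 !add0r.
Qed.

Lemma alpha_linearl w : linear (alpha f ^~ w).
Proof. by move=> a v v'; rewrite /alpha lin_inV cochain2_linearl. Qed.

Lemma alphaN v w : alpha f w v = - alpha f v w.
Proof.
by rewrite /alpha (cochain2_swap (homogV v) (homogV w)) scale1r.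
Qed.

Lemma alpha_linearr v : linear (alpha f v).
Proof.
by move=> a w w'; rewrite alphaN alpha_linearl opprD -scalerN -!alphaN.
Qed.

Lemma beta_linearl s : linear (beta f ^~ s).
Proof. by move=> a v v'; rewrite /beta lin_inV cochain2_linearl. Qed.

Lemma beta_linearr v : linear (beta f v).
Proof. by move=> a s s'; rewrite /beta lin_inS cochain2_linearr. Qed.

Lemma gamma_linearl s' : linear (gamma f ^~ s').
Proof. by move=> a s s1; rewrite /gamma lin_inS cochain2_linearl. Qed.

Lemma gammaC s s' : gamma f s s' = gamma f s' s.
Proof.
by rewrite /gamma (cochain2_swap (homogS s) (homogS s')) /= scaleN1r opprK.
Qed.

Lemma gamma_linearr s : linear (gamma f s).
Proof. by move=> a s1 s2; rewrite !(gammaC s) gamma_linearl. Qed.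

(** At [s = s'] and vanishing [alpha] this is the left side of the first normalised cocycle
    condition, [2 kappa(s, beta(v, s)) + gamma(s, s) v]. *)
Definition cocycleVSS v s s' : 'cV[R]_2 :=
  so_mx (gamma f s s') *m v + kappa s (beta f v s') + kappa s' (beta f v s)
    - alpha f v (kappa s s').

(** On the diagonal this is three times the left side of the second condition,
    [beta(kappa_s, s) + gamma(s, s) . s]. *)
Definition cocycleSSS s s' s'' : S :=
  rep_act S (gamma f s' s'') s + rep_act S (gamma f s s'') s'
    + rep_act S (gamma f s s') s''
  + (beta f (kappa s' s'') s + beta f (kappa s s'') s' + beta f (kappa s s') s'').

Lemma ce_homog2E e (x : 'I_3 -> sneg S) : ce_homog kappa 2 f e x =
  br kappa (inneg (x 0)) (f (args2 (x 1) (x 2)))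
  - (-1) ^+ (e 0 && e 1) *: br kappa (inneg (x 1)) (f (args2 (x 0) (x 2)))
  + (-1) ^+ (e 2 && (e 0 (+) e 1)) *:
      br kappa (inneg (x 2)) (f (args2 (x 0) (x 1)))
  + (- f (args2 (br_neg kappa (x 0) (x 1)) (x 2))
     - (-1) ^+ (e 0 && e 1) *: f (args2 (x 1) (br_neg kappa (x 0) (x 2)))
     + f (args2 (x 0) (br_neg kappa (x 1) (x 2)))).
Proof.
have E1 : (1 %% 3 = 1)%N by [].
have E2 : ((1 + 1) %% 3 = 2)%N by [].
rewrite /ce_homog !sum3c /= E1 E2 /=.
have fE (y : 'I_3 -> sneg S) i :
    f (y \o lift i) = f (args2 (y (lift i 0)) (y (lift i 1))).
  exact: args2E (fun u => f u) _.
rewrite !fE !lift3 /upd /= !addr0 !add0r.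
(* Folding the powers of [-1] into [sg] lets each exponent be replaced by its parity exactly once;
   rewriting the powers themselves would loop. *)
pose sg n : R := (-1) ^+ n; have sgE n : sg n = (-1) ^+ odd n.
  by rewrite signr_odd.
rewrite -![(-1) ^+ _]/(sg _) !sgE.
by case: (e 0); case: (e 1); case: (e 2);
  rewrite /= !expr0 !expr1 ?scale1r ?scaleN1r ?opprK.
Qed.

Lemma alpha0l w : alpha f 0 w = 0. Proof. exact: linearP0 (alpha_linearl w). Qed.
Lemma alpha0r v : alpha f v 0 = 0. Proof. exact: linearP0 (alpha_linearr v). Qed.
Lemma beta0l s : beta f 0 s = 0. Proof. exact: linearP0 (beta_linearl s). Qed.
Lemma beta0r v : beta f v 0 = 0. Proof. exact: linearP0 (beta_linearr v). Qed.
Lemma gamma0l s : gamma f 0 s = 0. Proof. exact: linearP0 (gamma_linearl s). Qed.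
Lemma gamma0r s : gamma f s 0 = 0. Proof. exact: linearP0 (gamma_linearr s). Qed.

(** The differential takes values in degree -1 on S * S * S and -2 when exactly one argument lies in
    [V]; with two or more arguments in [V] the degree is below -2, where the superalgebra is
    zero. *)
Lemma ce_homog2_hproj e (x : 'I_3 -> sneg S) :
  ce_homog kappa 2 f e (fun i => hproj (e i) (x i)) =
  match e 0, e 1, e 2 with
  | true, true, true => (0, - cocycleSSS (x 0).2 (x 1).2 (x 2).2, 0)
  | false, true, true => (- cocycleVSS (x 0).1 (x 1).2 (x 2).2, 0, 0)
  | true, false, true => (cocycleVSS (x 1).1 (x 0).2 (x 2).2, 0, 0)
  | true, true, false => (- cocycleVSS (x 2).1 (x 0).2 (x 1).2, 0, 0)
  | _, _, _ => 0
  end.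
Proof.
rewrite ce_homog2E !cochain2E /br_neg /br /inneg /cocycleVSS /cocycleSSS.
have Z : so_mx (0 : so R t) = 0 by [].
case: (e 0); case: (e 1); case: (e 2); apply: flatP => /=;
  rewrite ?so_comm ?expr0 ?expr1 ?scale1r ?scaleN1r
    ?(alpha0l, alpha0r, beta0l, beta0r, gamma0l, gamma0r, kappa0l, kappa0r,
    rep_act0l, rep_act0r, Z, mul0mx, mulmx0, oppr0, addr0, add0r, opprK, subr0,
    scaler0) //.
- rewrite !opprD; congr (_ + _).
  by rewrite [LHS]addrC addrA [RHS]addrAC.
- rewrite !kappaNr alphaN opprK !opprD opprK; congr (_ + _).
  by rewrite [LHS]addrC addrA.
- by rewrite kappaNr opprK; congr (_ + _ - _); rewrite addrC.
- by rewrite !opprD opprK.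
Qed.

Lemma cocycleVSS0 s s' : cocycleVSS 0 s s' = 0.
Proof.
by rewrite /cocycleVSS mulmx0 !beta0l alpha0l !kappa0r subr0 !addr0.
Qed.

Lemma cocycleSSS0 s s' : cocycleSSS 0 s s' = 0.
Proof.
rewrite /cocycleSSS !gamma0l !rep_act0l rep_act0r !kappa0l !beta0l beta0r.
by rewrite !addr0.
Qed.

Lemma cocycleP : ce kappa 2 f = 0 <->
  (forall v s s', cocycleVSS v s s' = 0) /\
  (forall s s' s'', cocycleSSS s s' s'' = 0).
Proof.
split=> [f0|[VSS0 SSS0]]; last first.
  apply/funext => x; rewrite /ce big1 // => e _; rewrite ce_homog2_hproj.
  by case: (e 0); case: (e 1); case: (e 2); rewrite ?VSS0 ?SSS0 ?oppr0.
split=> [v s s'|s s' s''].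
- pose x : 'I_3 -> sneg S :=
    fun i => if i == 0 then (v, 0) else (0, if i == 1 then s else s').
  have : ce kappa 2 f x = 0 by rewrite f0.
  (* The arguments are homogeneous, so every parity pattern but their own projects one of them to
     zero and contributes nothing. *)
  rewrite /ce (eq_bigr _ (fun (e : {ffun _ -> _}) _ => ce_homog2_hproj e x))
    (bigD1 [ffun i => i != 0]) // big1 => [|e ne].
    rewrite Monoid.mulm1 !ffunE => /(congr1 (fun u : flat S => u.1.1)).
    by move=> /= /eqP; rewrite oppr_eq0 => /eqP.
  rewrite /= cocycleSSS0 !cocycleVSS0 !oppr0.
  case E0: (e 0); case E1: (e 1); case E2: (e 2) => //; case/eqP: ne.
  by apply/ffunP; apply: ord3P; rewrite ffunE.
- pose x : 'I_3 -> sneg S :=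
    fun i => (0, if i == 0 then s else if i == 1 then s' else s'').
  have : ce kappa 2 f x = 0 by rewrite f0.
  rewrite /ce (eq_bigr _ (fun (e : {ffun _ -> _}) _ => ce_homog2_hproj e x))
    (bigD1 [ffun=> true]) // big1 => [|e ne].
    rewrite Monoid.mulm1 !ffunE => /(congr1 (fun u : flat S => u.1.2)).
    by move=> /= /eqP; rewrite oppr_eq0 => /eqP.
  rewrite /= !cocycleVSS0 !oppr0.
  case E0: (e 0); case E1: (e 1); case E2: (e 2) => //; case/eqP: ne.
  by apply/ffunP; apply: ord3P; rewrite ffunE.
Qed.
End TwoCochain.

(** Converse to [cochain2E]: it builds the coboundaries and the explicit cocycles from their three
    components. *)
Lemma is_cochain2 (a : 'cV[R]_2 -> 'cV[R]_2 -> 'cV[R]_2) (b : 'cV[R]_2 -> S -> S)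
    (c : S -> S -> so R t) :
  (forall v, linear (a v)) -> (forall v w, a w v = - a v w) ->
  (forall s, linear (b ^~ s)) -> (forall v, linear (b v)) ->
  (forall s, linear (c s)) -> (forall s s', c s s' = c s' s) ->
  is_cochain 2 (fun x : 'I_2 -> sneg S => (a (x 0).1 (x 1).1,
    b (x 0).1 (x 1).2 - b (x 1).1 (x 0).2, c (x 0).2 (x 1).2)).
Proof.
move=> al aN bl br cl cC.
have al' w : linear (a ^~ w).
  by move=> k v v'; rewrite aN al opprD -scalerN -!aN.
have cl' s : linear (c ^~ s) by move=> k s1 s2; rewrite !(cC _ s) cl.
have b0 v : b v 0 = 0 by exact: linearP0 (br v).
have b0' s : b 0 s = 0 by exact: linearP0 (bl s).
have c0 s : c s 0 = 0 by exact: linearP0 (cl s).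
have a0 v : a v 0 = 0 by exact: linearP0 (al v).
split.
- move=> x + k y z; apply: ord2P; rewrite /upd /=; apply: flatP => /=;
    rewrite ?al ?al' ?cl ?cl' //.
  + by rewrite bl br opprD scalerBr addrACA.
  + by rewrite bl br opprD scalerBr addrACA.
- move=> e x i j ex ij.
  have [-> ->] : i = 0 /\ j = 1.
    by move: i j ij; do 2!apply: ord2P => //.
  rewrite /= tpermL tpermR -(ex 0) -(ex 1) aN.
  case: (e 0); case: (e 1); rewrite /= ?expr0 ?expr1 ?scale1r ?scaleN1r ?opprK;
    by apply: flatP; rewrite /= ?opprB // ?b0 ?b0' ?a0 ?c0 ?(cC 0) ?c0
      ?subr0 ?oppr0 // cC.
- move=> e x ex; rewrite sum2 -(ex 0) -(ex 1).
  by case: (e 0); case: (e 1); split => //= _; rewrite ?b0 ?b0' ?a0 ?c0 ?(cC 0)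
     ?c0 ?(aN _ 0) ?a0 ?subr0 ?oppr0.
Qed.

(** * The space of 1-cochains of degree 2 and their coboundaries *)

Section OneCochain.
Variable b : cochain S 2 1.

Definition rotation v : so R t := (b (fun=> (v, 0))).2.

Lemma rotation_linear : linear rotation.
Proof.
have [bl _ _] := cochainP b; move=> a v w; rewrite /rotation lin_inV.
have U (u : sneg S) : (fun=> u) = upd (fun=> 0) ord0 u :> ('I_1 -> sneg S).
  by apply/funext => i; rewrite (ord1 i).
by rewrite (U (_ + _)) bl -!U.
Qed.

(** A map of degree 2 sends [S] into degree 1, where the superalgebra is zero, and [V] into degree
    0, which is [so(V)]. *)
Lemma cochain1E (u : 'I_1 -> sneg S) : b u = (0, 0, rotation (u 0).1).
Proof.
have [bl _ bd] := cochainP b.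
(* The scalar [1] gives the splitting into [V] and [S] parts the shape that multilinearity
   expects. *)
have uE : u = upd u 0 (1 *: ((u 0).1, 0) + (0, (u 0).2)).
  apply/funext => i; rewrite (ord1 i) /upd eqxx scale1r.
  by case: (u 0) => a c; congr (_, _); rewrite /= ?addr0 ?add0r.
have U (y : sneg S) : upd u 0 y = (fun=> y).
  by apply/funext => i; rewrite (ord1 i).
rewrite [in LHS]uE bl scale1r !U /rotation.
have := bd (fun=> false) (fun=> ((u 0).1, 0)) (fun=> erefl _).
have := bd (fun=> true) (fun=> (0, (u 0).2)) (fun=> erefl _).
rewrite !big_ord1 /= => -[x1 x2 x3] [y1 y2 _]; apply: flatP => /=.
- by rewrite x1 // y1 // addr0.
- by rewrite x2 // y2 // addr0.
- by rewrite x3 // addr0.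
Qed.

Lemma ce_homog1E e (x : 'I_2 -> sneg S) : ce_homog kappa 2 b e x =
  br kappa (inneg (x 0)) (0, 0, rotation (x 1).1)
  - (-1) ^+ (e 0 && e 1) *: br kappa (inneg (x 1)) (0, 0, rotation (x 0).1)
  - (0, 0, rotation (kappa (x 0).2 (x 1).2)).
Proof.
have L0 : lift (0 : 'I_2) (0 : 'I_1) = 1 by apply/val_inj.
have L1 : lift (1 : 'I_2) (0 : 'I_1) = 0 by apply/val_inj.
rewrite /ce_homog !sum2c /=.
rewrite !addr0 !add0r !cochain1E /= L0 L1 !mul0mx subr0 add0r.
pose sg n : R := (-1) ^+ n; have sgE n : sg n = (-1) ^+ odd n.
  by rewrite signr_odd.
rewrite -![(-1) ^+ _]/(sg _) !sgE.
by case: (e 0); case: (e 1); rewrite /= !expr0 !expr1 ?scale1r ?scaleN1r ?opprK.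
Qed.

Lemma ce1E (x : 'I_2 -> sneg S) : ce kappa 2 b x =
  (so_mx (rotation (x 0).1) *m (x 1).1 - so_mx (rotation (x 1).1) *m (x 0).1,
   rep_act S (rotation (x 0).1) (x 1).2 - rep_act S (rotation (x 1).1) (x 0).2,
   - rotation (kappa (x 0).2 (x 1).2)).
Proof.
have r0 : rotation 0 = 0 by exact: linearP0 rotation_linear.
have Z : so_mx (0 : so R t) = 0 by [].
rewrite /ce sum_ffun2 !ce_homog1E !ffunE /br /=; apply: flatP => /=;
  rewrite ?so_comm ?expr0 ?expr1 ?scale1r ?scaleN1r ?(r0, kappa0l, kappa0r,
    rep_act0l, rep_act0r, Z, mul0mx, mulmx0, oppr0, addr0, add0r, opprK, subr0,
    sub0r, scaler0) //.
by rewrite addrC.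
Qed.

Lemma coboundary1_cochain : is_cochain 2 (ce kappa 2 b).
Proof.
rewrite (_ : ce kappa 2 b = fun x : 'I_2 -> sneg S =>
   (so_mx (rotation (x 0).1) *m (x 1).1 - so_mx (rotation (x 1).1) *m (x 0).1,
    rep_act S (rotation (x 0).1) (x 1).2 - rep_act S (rotation (x 1).1) (x 0).2,
    - rotation (kappa (x 0).2 (x 1).2))); last by apply/funext => x; exact: ce1E.
have rl := rotation_linear; have kl := dirac_linear kappa.
apply: (is_cochain2
  (a := fun v w => so_mx (rotation v) *m w - so_mx (rotation w) *m v)
  (b := fun v s => rep_act S (rotation v) s)
  (c := fun s s' => - rotation (kappa s s'))).
- move=> v a w w'; rewrite rl /= !(mulmxDr, mulmxDl) -scalemxAr -scalemxAl.
  by rewrite scalerBr opprD addrACA.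
- by move=> v w; rewrite opprB.
- by move=> s a v v'; rewrite rl rep_linearl.
- by move=> v a s s'; rewrite rep_linearr.
- by move=> s a s1 s2; rewrite kl rl opprD scalerN.
- by move=> s s'; rewrite dirac_sym.
Qed.

Definition coboundary1 : cochain S 2 2 := Cochain (asboolT coboundary1_cochain).

Lemma coboundary1_beta v s : beta coboundary1 v s = rep_act S (rotation v) s.
Proof.
by rewrite /beta /= ce1E /= (linearP0 rotation_linear) rep_act0l subr0.
Qed.

Lemma coboundary1_alpha v w : alpha coboundary1 v w =
  so_mx (rotation v) *m w - so_mx (rotation w) *m v.
Proof. by rewrite /alpha /= ce1E. Qed.

Lemma coboundary1_gamma s s' : gamma coboundary1 s s' = - rotation (kappa s s').
Proof. by rewrite /gamma /= ce1E. Qed.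

(** On V * S * S this is the equivariance of [kappa] under [rotation b v]; on S * S * S the
    contributions of [gamma] and [beta] cancel in pairs. *)
Lemma ce_coboundary1 : ce kappa 2 coboundary1 = 0.
Proof.
apply/cocycleP; split=> [v s s'|s s' s''].
- rewrite /cocycleVSS coboundary1_gamma !coboundary1_beta coboundary1_alpha.
  rewrite -[so_mx (- _)]/(- so_mx (rotation (kappa s s'))).
  rewrite dirac_equiv mulNmx opprB.
  rewrite [kappa (rep_act S _ s) s']dirac_sym.
  have E (x y z : 'cV[R]_2) : - x + y + z + (x - (z + y)) = 0.
    by apply/matrixP=> i j; rewrite !mxE; ring.
  exact: E.
- rewrite /cocycleSSS !coboundary1_gamma !coboundary1_beta.
  have N A u : rep_act S (- A) u = - rep_act S A u.
    by have := Defs.linearPZ (@rep_linearl _ _ S u) (-1) A; rewrite /= !scaleN1r.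
  by rewrite !N -!opprD addNr.
Qed.
End OneCochain.

(** * Normalisation of cocycles by coboundaries, and the action of so(V) on [beta] *)

Lemma is_cochain1 (l : 'cV[R]_2 -> so R t) : linear l ->
  is_cochain 2 (fun x : 'I_1 -> sneg S => (0, 0, l (x 0).1)).
Proof.
move=> ll; split.
- move=> x i a y z; rewrite (ord1 i) !updE /= ll.
  by apply: flatP => //=; rewrite scaler0 addr0.
- by move=> e x i j _; rewrite (ord1 i) (ord1 j).
- move=> e x ex; rewrite big_ord1; split => //= + .
  by rewrite -(ex 0); case: (e 0) => //= _; exact: linearP0 ll.
Qed.

Lemma cV2E v : v = v 0 0 *: e_ R 0 + v 1 0 *: e_ R 1.
Proof.
by apply/matrixP; apply: ord2P => j; rewrite (ord1 j) !mxE /=; ring.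
Qed.

Lemma so_gen_so : so_gen R t \in @so_pred R t.
Proof.
rewrite inE; apply/eqP; case: t; rewrite /= !mxE2 [RHS]mx2E !mxE;
  congr mx2; ring.
Qed.

Lemma normalise (f : cochain S 2 2) : ce kappa 2 f = 0 ->
  exists (n : cochain S 2 2) (b : cochain S 2 1),
    normalised_cocycle kappa n /\ f = n + coboundary1 b.
Proof.
move=> f0; pose a := alpha f (e_ R 0) (e_ R 1).
(* The generator sends the second basis vector to the first, and the first to [so_gen R t 1 0] times
   the second. This entry is a sign, with square 1, so [l_(e_0) e_1 - l_(e_1) e_0 = a]. *)
pose l v : so R t :=
  (v 0 0 * a 0 0 - v 1 0 * (so_gen R t 1 0 * a 1 0)) *: So so_gen_so.
have ll : linear l.
  move=> k v w; rewrite /l scalerA -scalerDl; congr (_ *: _).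
  by rewrite !mxE; ring.
pose b := Cochain (asboolT (is_cochain1 ll)).
exists (f - coboundary1 b), b; split; last by rewrite subrK.
split=> [|v w].
  transitivity (ce kappa 2 f - ce kappa 2 (coboundary1 b)).
    exact: (linearPB (@ce_linear R t S kappa 2 2)).
  by rewrite f0 ce_coboundary1 subrr.
have -> : alpha (f - coboundary1 b) v w = alpha f v w - alpha (coboundary1 b) v w.
  by [].
rewrite coboundary1_alpha.
have rE u : rotation b u = l u by [].
have Dl u := Defs.linearPD (alpha_linearl f u).
have Zl u := Defs.linearPZ (alpha_linearl f u).
have Dr u := Defs.linearPD (alpha_linearr f u).
have Zr u := Defs.linearPZ (alpha_linearr f u).
(* Being alternating on a plane, [alpha] is determined by its value [a] on the two basis vectors. *)
rewrite !rE [in alpha f v w](cV2E v) [in alpha f _ w](cV2E w) !(Dl, Zl, Dr, Zr).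
have A0 u : alpha f u u = 0.
  by move/eqP: (alphaN f u u); rewrite -subr_eq0 opprK -mulr2n
    -scaler_nat scaler_eq0 Num.Theory.pnatr_eq0 => /eqP.
rewrite !A0 (alphaN f (e_ R 0) (e_ R 1)) -/a.
rewrite /l /=; apply/matrixP => i j; rewrite (ord1 j) !mxE !sum2 !mxE.
move: i; apply: ord2P; case: t so_gen_so => h; rewrite /= !mxE /=; ring.
Qed.

(** By [normalise], a cocycle whose normalised part vanishes is a coboundary. *)
Lemma spencer_eq0 (h : spencer kappa 2 2) :
  (forall n : cochain S 2 2, normalised_cocycle kappa n -> n = 0) -> h = 0.
Proof.
move=> N; rewrite -[h]reprK; set c := repr h.
have c0 : ce kappa 2 c = 0 by have := cocycle_valP c; rewrite !inE.
have [n [b [/N n0 cE]]] := normalise c0.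
rewrite -(linearP0 (pi_lquot_linear (coboundary_submod kappa 2 2))).
apply/(eqlquotP (coboundary_submod kappa 2 2)); rewrite subr0 !inE.
by exists b; rewrite cE n0 add0r.
Qed.

Lemma beta_so A (f : cochain S 2 2) (v : 'cV[R]_2) (s : S) :
  beta (so_cochain kappa A f) v s =
  rep_act S A (beta f v s) - beta f (so_mx A *m v) s - beta f v (rep_act S A s).
Proof.
rewrite {1}/beta -[cochain_val _ _]/(so_hom kappa A f (args2 (v, 0) (0, s))).
rewrite /so_hom sum2 br_so.
have -> : upd (args2 (v, 0) (0, s)) 0 (so_neg kappa A (args2 (v, 0) (0, s) 0)) =
    args2 (so_mx A *m v, 0) (0, s).
  by rewrite so_negE /= rep_act0r; apply/funext; apply: ord2P.
have -> : upd (args2 (v, 0) (0, s)) 1 (so_neg kappa A (args2 (v, 0) (0, s) 1)) =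
    args2 (v, 0) (0, rep_act S A s).
  by rewrite so_negE /= mulmx0; apply/funext; apply: ord2P.
by rewrite /beta /= opprD addrA.
Qed.
End Cochains.

(** * Half spinors in signature (1,1): uniqueness of the Dirac current and vanishing of
    cohomology *)

Section Half.
Variable R : realType.

Lemma half_snd (s : Defs.half R) : s 1 0 = 0 :> R.
Proof.
have := half_valP s; rewrite inE Gamma_starE => /eqP/matrixP/(_ 1 0).
rewrite mxE sum2 !mxE /=; lra.
Qed.

Lemma half_gen_subproof : e_ R 0 \in @half_pred R.
Proof.
rewrite inE Gamma_starE; apply/eqP/matrixP; apply: ord2P => j.
  by rewrite (ord1 j) mxE sum2 !mxE /=; ring.
by rewrite (ord1 j) mxE sum2 !mxE /=; ring.
Qed.

Definition half_gen : Defs.half R := Half half_gen_subproof.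

Lemma half_span (s : Defs.half R) : s = s 0 0 *: half_gen.
Proof.
apply/val_inj/matrixP; apply: ord2P => j; rewrite (ord1 j) !mxE /=.
  by rewrite mulr1.
by rewrite half_snd mulr0.
Qed.

Lemma half_actE A s : half_act A s = (so_mx A 0 1 / 2) *: s :> Defs.half R.
Proof.
apply/val_inj => /=; rewrite /pinor_act spinE -scalemxAl.
by rewrite (eqP (half_valP s)).
Qed.

(** The vector [const_mx 1] is null and an eigenvector of the boost generator with eigenvalue 1,
    which is the sum of the weights 1/2 of two elements of [S_+]. *)
Definition half_dirac (s s' : Defs.half R) : 'cV[R]_2 :=
  (s 0 0 * s' 0 0) *: const_mx 1.

Lemma half_dirac_linear s : linear (half_dirac s).
Proof.
move=> a s1 s2; rewrite /half_dirac scalerA -scalerDl; congr (_ *: _).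
by rewrite !mxE; ring.
Qed.

Lemma half_dirac_sym s s' : half_dirac s s' = half_dirac s' s.
Proof. by rewrite /half_dirac mulrC. Qed.

Lemma half_dirac_equiv (A : so R Sig11) s s' : so_mx A *m half_dirac s s' =
  half_dirac (half_act A s) s' + half_dirac s (half_act A s').
Proof.
rewrite !half_actE soE /half_dirac; apply/matrixP => i j.
rewrite !mxE sum2 !mxE /=.
by move: i; apply: ord2P => /=; field.
Qed.

Definition half_current : dirac_current (half_pinor R) :=
  @DiracCurrent R Sig11 (half_pinor R) half_dirac half_dirac_linear
    half_dirac_sym half_dirac_equiv.

Variable kappa : dirac_current (half_pinor R).

(** Since [S_+] is a line, a current is determined by its value on the generator. Equivariance makes
    this value fixed by the boost generator, which swaps the two coordinates, so they are equal. *)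
Lemma half_currentE (s s' : Defs.half R) :
  kappa s s' = kappa half_gen half_gen 0 0 *: half_current s s'.
Proof.
pose w := kappa half_gen half_gen.
have E : w 0 0 = w 1 0.
  have := dirac_equiv kappa (So (so_gen_so R Sig11)) half_gen half_gen.
  rewrite /= !half_actE (dirac_sym kappa (_ *: _)).
  rewrite (Defs.linearPZ (dirac_linear kappa _)).
  move=> /matrixP/(_ 1 0); rewrite !mxE sum2 !mxE /= -/w; lra.
rewrite [in LHS](half_span s) [in LHS](half_span s').
rewrite (Defs.linearPZ (dirac_linear kappa _)) dirac_sym.
rewrite (Defs.linearPZ (dirac_linear kappa _)) -/w /= /half_dirac.
apply/matrixP => i j; rewrite (ord1 j) !mxE; move: i.
by apply: ord2P; rewrite -?E; ring.
Qed.

Hypothesis kappa_neq0 : nontrivial kappa.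

Lemma half_current_coef : kappa half_gen half_gen 0 0 != 0.
Proof.
have [s [s' ]] := kappa_neq0; rewrite half_currentE.
by apply: contraNneq => ->; rewrite scale0r.
Qed.

(** For [v = e_ R mu] and [s = s' = h] the V * S * S condition is a relation between a multiple of
    the null vector (1,1) and a multiple of the other basis vector. These are independent, so both
    coefficients vanish, and [kappa] being nontrivial then kills [beta]. *)
Lemma half_normalised_eq0 (n : cochain (half_pinor R) 2 2) :
  normalised_cocycle kappa n -> n = 0.
Proof.
move=> [/(cocycleP kappa n)[V _] a0].
set h : half_pinor R := half_gen.
have w0 := half_current_coef.
have bE (v : 'cV[R]_2) : beta n v h = half_val (beta n v h) 0 0 *: h.
  exact: half_span.
have E mu : half_val (beta n (e_ R mu) h) 0 0 = 0 /\ so_mx (gamma n h h) 0 1 = 0.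
  have /matrixP M := V (e_ R mu) h h; move: (M 0 0) (M 1 0) => {M}.
  rewrite /cocycleVSS a0 bE (Defs.linearPZ (dirac_linear kappa _)) half_currentE.
  rewrite soE /= /half_dirac !mxE !sum2 !mxE /=.
  set k := kappa _ _ 0 0; set p := beta n _ _ 0 0; set g := gamma n _ _ 0 1.
  move: mu @p; apply: ord2P => p /= e0 e1.
    have pk : p * k = 0 by lra.
    split; last by lra.
    by move/eqP: pk; rewrite mulf_eq0 (negPf w0) orbF => /eqP->; rewrite mul0r.
  have pk : p * k = 0 by lra.
  split; last by lra.
  by move/eqP: pk; rewrite mulf_eq0 (negPf w0) orbF => /eqP->; rewrite mul0r.
have g0 s s' : gamma n s s' = 0.
  rewrite (half_span s) (half_span s') (Defs.linearPZ (gamma_linearl n _)).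
  rewrite (Defs.linearPZ (gamma_linearr n _)) (_ : gamma n _ _ = 0) ?scaler0 //.
  by apply/val_inj; rewrite /= soE (E 0).2 scale0r.
have b1 mu : beta n (e_ R mu) h = 0 by rewrite bE (E mu).1 scale0r.
have b0 v s : beta n v s = 0.
  rewrite (half_span s) (Defs.linearPZ (beta_linearr n _)).
  rewrite (cV2E v) (Defs.linearPD (beta_linearl n _)).
  rewrite !(Defs.linearPZ (beta_linearl n _)).
  by rewrite !b1 !scaler0 addr0 scaler0.
apply/val_inj/funext => x; transitivity (n (args2 (x 0) (x 1))).
  exact: args2E (fun u => n u) x.
by rewrite cochain2E a0 !b0 g0 subr0.
Qed.
End Half.

(** * Cochains on the pinor module as triples of real 2 by 2 matrices *)

Section Coefficients.
Variables (R : realType) (t : signature).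
Implicit Types (f n : cochain (pinor R t) 2 2) (s v : 'cV[R]_2).

Definition beta_coef f mu : 'M[R]_2 :=
  \matrix_(i, j) (beta f (e_ R mu) (e_ R j) : 'cV_2) i 0.

(** As so(V) is a line, [gamma] is a scalar bilinear form times [so_gen]; the entry (0,1) is the
    coordinate because that entry of [so_gen] is 1. *)
Definition gamma_coef f : 'M[R]_2 :=
  \matrix_(i, j) so_mx (gamma f (e_ R i) (e_ R j)) 0 1.

Lemma betaE f v s : beta f v s =
  (v 0 0 *: beta_coef f 0 + v 1 0 *: beta_coef f 1) *m s :> 'cV_2.
Proof.
rewrite [in LHS](cV2E v) [in LHS](cV2E s).
rewrite (Defs.linearPD (beta_linearl f _)) !(Defs.linearPZ (beta_linearl f _)).
rewrite !(Defs.linearPD (beta_linearr f _)) !(Defs.linearPZ (beta_linearr f _)).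
apply/matrixP => i j; rewrite (ord1 j) !mxE sum2 !mxE; ring.
Qed.

Lemma gamma_coefC f : gamma_coef f 1 0 = gamma_coef f 0 1.
Proof. by rewrite !mxE gammaC. Qed.

Lemma gammaE f s s' : so_mx (gamma f s s') =
  (s^T *m gamma_coef f *m s') 0 0 *: so_gen R t.
Proof.
rewrite soE; congr (_ *: _); rewrite [in LHS](cV2E s) [in LHS](cV2E s').
rewrite (Defs.linearPD (gamma_linearl f _)) !(Defs.linearPZ (gamma_linearl f _)).
rewrite !(Defs.linearPD (gamma_linearr f _)) !(Defs.linearPZ (gamma_linearr f _)).
rewrite /= !mxE !sum2 !mxE !sum2 !mxE; ring.
Qed.

Definition explicit_beta b (c : R) mu : 'M[R]_2 :=
  match b with
  | Bsym => c *: (\sum_nu eps R mu nu *: Gamma_up R t nu)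
  | Bskew => c *: Gamma R t mu
  end.

(** One matrix serves both choices of [B], because [-Omega *m Gamma_star] is the matrix of the
    symmetric form in either signature. The minus sign in signature (1,1) comes from lowering an
    index with [eta_00 = -1]. *)
Definition explicit_gamma (c : R) : 'M[R]_2 :=
  match t with
  | Sig11 => mx2 0 (- 2 * c) (- 2 * c) 0
  | Sig02 => mx2 (2 * c) 0 0 (2 * c)
  end.

Lemma explicitP b c f : explicit_cocycle b c f <->
  [/\ forall v w, alpha f v w = 0,
      forall mu, beta_coef f mu = explicit_beta b c mu
    & gamma_coef f = explicit_gamma c].
Proof.
split=> [[a0 bE gE]|[a0 bE gE]]; split=> //.
- move=> mu; apply/matrixP => i j; rewrite mxE bE; case: b {bE gE};
    by rewrite -colE mxE.
(* The symmetric form [gamma] is recovered by polarisation from its values at the two basis spinors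
   and at their sum. *)
- have g s := gE s 0 1; move: (g (e_ R 0)) (g (e_ R 1)) (g (e_ R 0 + e_ R 1)).
  rewrite !e_mulmx !gammaE [gamma_coef f]mx2E gamma_coefC /explicit_gamma.
  rewrite Gamma_starE /Bform /eps.
  move: (gamma_coef f 0 0) (gamma_coef f 0 1) (gamma_coef f 1 1) => x y z.
  case: t b {f a0 bE gE g} => -[];
    rewrite /= !mxE !sum2 !mxE !sum2 !mxE /= => g0 g1 g2; congr mx2; lra.
- move=> mu s; rewrite betaE !bE.
  by move: mu; apply: ord2P; case: b {bE};
    rewrite !mxE /= ?scale1r ?scale0r ?addr0 ?add0r.
- move=> s; apply: ord2P; apply: ord2P;
    rewrite e_mulmx gammaE gE /explicit_gamma /Bform Gamma_starE /eps;
    case: t b {f a0 bE gE} => -[]; rewrite /= !mxE !sum2 !mxE !sum2 !mxE /=; ring.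
Qed.

End Coefficients.

(** * Normalised cocycles on the pinor module *)

Section Pinor.
Variables (R : realType) (t : signature).
Implicit Types (f n : cochain (pinor R t) 2 2) (s v : 'cV[R]_2).

Lemma pinor_current0 b s s' : current t b s s' 0 0 =
  match t, b with
  | Sig02, Bskew => - (s 0 0 * s' 1 0 + s 1 0 * s' 0 0)
  | Sig11, Bskew => s 0 0 * s' 0 0 + s 1 0 * s' 1 0
  | _, Bsym => s 0 0 * s' 0 0 - s 1 0 * s' 1 0
  end.
Proof.
by rewrite /current invmx_eta /Bform; case: t b => -[];
  rewrite /= !mxE !sum2 !mxE !sum2 !mxE !sum2 !mxE /= ?sum2 ?mxE /=; ring.
Qed.

Lemma pinor_current1 b s s' : current t b s s' 1 0 =
  match t, b with
  | Sig02, Bsym => s 0 0 * s' 1 0 + s 1 0 * s' 0 0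
  | Sig11, Bsym => s 0 0 * s' 0 0 + s 1 0 * s' 1 0
  | _, Bskew => s 0 0 * s' 0 0 - s 1 0 * s' 1 0
  end.
Proof.
by rewrite /current invmx_eta /Bform; case: t b => -[];
  rewrite /= !mxE !sum2 !mxE !sum2 !mxE !sum2 !mxE /= ?sum2 ?mxE /=; ring.
Qed.

(** For an explicit cocycle [beta_0] is [c Gamma_1] in the symmetric case and [c Gamma_0] in the
    skew one. Since [Gamma_1] squares to 1 and [Gamma_0] to [eta_00], with [eta_00 ^ 2 = 1], half
    the trace is [c]. *)
Definition charge b f : R :=
  2^-1 * \tr (match b with
              | Bsym => Gamma R t 1
              | Bskew => etamx R t 0 0 *: Gamma R t 0
              end *m beta_coef f 0).

Lemma explicit_charge b c f : explicit_cocycle b c f -> charge b f = c.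
Proof.
move=> /explicitP[_ bE _]; rewrite /charge bE {f bE} /explicit_beta !sum2.
rewrite /Gamma_up invmx_eta !sum2 /mxtrace /eps.
by case: t b => -[]; rewrite /= !sum2 !mxE /= !sum2 !mxE /=; field.
Qed.

(** On basis vectors the V * S * S condition gives twelve linear equations in the eight entries of
    [beta] and the three of the symmetric form [gamma]. Their solutions form a line, with [charge]
    as coordinate. *)
Lemma normalised_explicit b f : normalised_cocycle (pinor_current R t b) f ->
  explicit_cocycle b (charge b f) f.
Proof.
move=> [/(cocycleP (pinor_current R t b) f)[V _] a0]; apply/explicitP.
suff [B0 B1 GE] : [/\ beta_coef f 0 = explicit_beta t b (charge b f) 0,
    beta_coef f 1 = explicit_beta t b (charge b f) 1
  & gamma_coef f = explicit_gamma t (charge b f)] by split=> //; apply: ord2P.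
pose be v : 'M[R]_2 := v 0 0 *: beta_coef f 0 + v 1 0 *: beta_coef f 1.
have {}V v s s' k : (s^T *m gamma_coef f *m s') 0 0 * (so_gen R t *m v) k 0
    + current t b s (be v *m s') k 0 + current t b s' (be v *m s) k 0 = 0
  by have := congr1 (fun M : 'cV[R]_2 => M k 0) (V v s s');
     rewrite /cocycleVSS a0 gammaE subr0 -scalemxAl /= !betaE
       !addmx_entry scalemx_entry zeromx_entry.
rewrite {}/be in V.
move: (gamma_coefC f) (pinor_current0 b) (pinor_current1 b) V.
rewrite /charge.
move: (beta_coef f) (gamma_coef f) (current t b) => B G K GC K0 K1 V.
(* The digits in the names are the index of the vector, the sum of the indices of the two spinors,
   and the component of the equation. *)
have v000 := V (e_ R 0) (e_ R 0) (e_ R 0) 0.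
have v001 := V (e_ R 0) (e_ R 0) (e_ R 0) 1.
have v010 := V (e_ R 0) (e_ R 0) (e_ R 1) 0.
have v011 := V (e_ R 0) (e_ R 0) (e_ R 1) 1.
have v020 := V (e_ R 0) (e_ R 1) (e_ R 1) 0.
have v021 := V (e_ R 0) (e_ R 1) (e_ R 1) 1.
have v100 := V (e_ R 1) (e_ R 0) (e_ R 0) 0.
have v101 := V (e_ R 1) (e_ R 0) (e_ R 0) 1.
have v110 := V (e_ R 1) (e_ R 0) (e_ R 1) 0.
have v111 := V (e_ R 1) (e_ R 0) (e_ R 1) 1.
have v120 := V (e_ R 1) (e_ R 1) (e_ R 1) 0.
have v121 := V (e_ R 1) (e_ R 1) (e_ R 1) 1.
clear V f a0.
rewrite !(K0, K1, mulmx2_entry, form2_entry, addmx_entry, scalemx_entry,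
    e_entry, GC, mul0r, mulr0, mul1r, mulr1, add0r, addr0)
  in v000 v001 v010 v011 v020 v021 v100 v101 v110 v111 v120 v121.
rewrite [B 0]mx2E [B 1]mx2E [G]mx2E GC /mxtrace !sum2.
move: v000 v001 v010 v011 v020 v021 v100 v101 v110 v111 v120 v121.
move: (G 0 0) (G 0 1) (G 1 1) => g00 g01 g11 {GC G}.
move: (B 0 0 0) (B 0 0 1) (B 0 1 0) (B 0 1 1) => a00 a01 a10 a11.
move: (B 1 0 0) (B 1 0 1) (B 1 1 0) (B 1 1 1) => b00 b01 b10 b11 {B}.
rewrite {K0 K1 K} /explicit_gamma /explicit_beta; case: t b => -[].
all: rewrite /= /Gamma_up ?invmx_eta /= !mxE /= !sum2 !mxE /= => *.
all: rewrite /eps /Omega /sigma1 /sigma3 /= !mxE2.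
all: split; congr mx2; lra.
Qed.

(** In coordinates both cocycle conditions become polynomial identities, checked for each signature
    and each form; the S * S * S condition is verified here for the whole line of solutions. *)
Lemma explicit_normalised b c f : explicit_cocycle b c f ->
  normalised_cocycle (pinor_current R t b) f.
Proof.
move=> /explicitP[a0 bE gE].
split=> //; apply/cocycleP; split=> [v s s'|s s' s''].
- rewrite /cocycleVSS a0 gammaE subr0 /= !betaE !bE gE -scalemxAl.
  move: (pinor_current0 b) (pinor_current1 b).
  move: (current t b) => K K0 K1; apply/matrixP; apply: ord2P => j;
    rewrite (ord1 j) !(K0, K1, mulmx2_entry, form2_entry, addmx_entry,
      scalemx_entry, zeromx_entry) {K K0 K1 f a0 bE gE}; case: t b => -[];
    rewrite /explicit_gamma /explicit_beta /Gamma_up ?invmx_eta /= ?sum2 /eps /=;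
    rewrite ?(addmx_entry, scalemx_entry) /= !mxE /=; ring.
- rewrite /cocycleSSS /= /pinor_act !spinE !gammaE !betaE !bE gE -!scalemxAl.
  move: (pinor_current0 b) (pinor_current1 b); rewrite Gamma_starE.
  move: (current t b) => K K0 K1; apply/matrixP; apply: ord2P => j;
    rewrite (ord1 j) !(K0, K1, mulmx2_entry, form2_entry, addmx_entry,
      scalemx_entry, zeromx_entry) {K K0 K1 f a0 bE gE}; case: t b => -[];
    rewrite /explicit_gamma /explicit_beta /Gamma_up ?invmx_eta /= ?sum2 /eps /=;
    rewrite ?(addmx_entry, scalemx_entry) /= !mxE /=; by field.
Qed.

Lemma explicit_cochain b c : exists f, @explicit_cocycle R t b c f.
Proof.
pose be v s : pinor R t :=
  (v 0 0 *: explicit_beta t b c 0 + v 1 0 *: explicit_beta t b c 1) *m s.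
pose ga (s s' : pinor R t) :=
  (s^T *m explicit_gamma t c *m s') 0 0 *: So (so_gen_so R t).
have F : is_cochain 2 (fun x : 'I_2 -> sneg (pinor R t) => (0,
    be (x 0).1 (x 1).2 - be (x 1).1 (x 0).2, ga (x 0).2 (x 1).2)).
  apply: (is_cochain2 (a := fun _ _ => 0)).
  - by move=> v a w w'; rewrite scaler0 addr0.
  - by move=> v w; rewrite oppr0.
  - move=> s a v w; rewrite /be !addmx_entry !scalemx_entry !scalerDl -!scalerA.
    by rewrite addrACA -scalerDr mulmxDl -scalemxAl.
  - by move=> v a s s'; rewrite /be mulmxDr scalemxAr.
  - move=> s a s1 s2; rewrite /ga scalerA -scalerDl; congr (_ *: _).
    by rewrite mulmxDr -scalemxAr addmx_entry scalemx_entry.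
  - move=> s s'; congr (_ *: _); rewrite !form2_entry /explicit_gamma.
    by case: (t); rewrite !mx2_entry; ring.
pose f : cochain (pinor R t) 2 2 := Cochain (asboolT F).
have be0 s : be 0 s = 0 by rewrite /be !zeromx_entry !scale0r addr0 mul0mx.
have bE v s : beta f v s = be v s by rewrite /beta /= be0 subr0.
exists f; apply/explicitP; split=> // [mu|].
  apply/matrixP => i j; rewrite mxE bE /be.
  rewrite mulmx2_entry !addmx_entry !scalemx_entry.
  by move: mu j; apply: ord2P; apply: ord2P; rewrite !e_entry; ring.
apply/matrixP => i j; rewrite mxE /gamma /= /ga scalemx_entry form2_entry.
have -> : so_gen R t 0 1 = 1 by case: (t); rewrite mx2_entry.
by move: i j; apply: ord2P; apply: ord2P; rewrite !e_entry; ring.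
Qed.

Lemma explicit_inj b c f n : explicit_cocycle b c f -> explicit_cocycle b c n ->
  f = n.
Proof.
move=> /explicitP[a bE gE] /explicitP[a' bE' gE'].
apply/val_inj/funext => x.
transitivity (f (args2 (x 0) (x 1))); first exact: args2E (fun u => f u) x.
transitivity (n (args2 (x 0) (x 1))); last exact/esym/(args2E (fun u => n u) x).
have be v s : beta f v s = beta n v s by rewrite !betaE !bE !bE'.
have ge s s' : gamma f s s' = gamma n s s'.
  by apply/val_inj; rewrite /= !gammaE gE gE'.
by rewrite !cochain2E a a' !be ge.
Qed.

Lemma beta_cochain_linear a f n v s :
  beta (a *: f + n) v s = a *: beta f v s + beta n v s.
Proof. by []. Qed.

Lemma beta_coef_linear a f n mu :
  beta_coef (a *: f + n) mu = a *: beta_coef f mu + beta_coef n mu.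
Proof.
apply/matrixP => i j; rewrite mxE beta_cochain_linear.
rewrite [RHS]addmx_entry [X in _ = X + _]scalemx_entry ![beta_coef _ _ _ _]mxE.
exact: etrans (addmx_entry _ _ _ _) (congr1 (+%R^~ _) (scalemx_entry _ _ _ _)).
Qed.

Lemma charge_linear b : linear (charge b : cochain (pinor R t) 2 2 -> R^o).
Proof.
move=> a f n; rewrite /charge beta_coef_linear.
move: (beta_coef f 0) (beta_coef n 0) => M N.
by rewrite mulmxDr -scalemxAr linearD linearZ /= mulrDr mulrCA.
Qed.

(** The map [beta] of a coboundary is the spin action of a rotation, a multiple of [Gamma_star]; the
    product of [Gamma_star] with either [Gamma mu] is traceless. *)
Lemma charge_coboundary1 b l :
  charge b (coboundary1 (pinor_current R t b) l) = 0.
Proof.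
have E : beta_coef (coboundary1 (pinor_current R t b) l) 0 =
    (so_mx (rotation l (e_ R 0)) 0 1 / 2) *: Gamma_star R t.
  apply/matrixP => i j.
  rewrite mxE coboundary1_beta /= /pinor_act spinE -scalemxAl.
  by rewrite !scalemx_entry -colE mxE.
rewrite /charge E -scalemxAr linearZ /=.
suff -> : \tr (match b with
              | Bsym => Gamma R t 1
              | Bskew => etamx R t 0 0 *: Gamma R t 0
              end *m Gamma_star R t) = 0 by rewrite !mulr0.
rewrite Gamma_starE /mxtrace; case: (t); case: b l E => *;
  by rewrite !sum2 !mxE !sum2 !mxE /=; ring.
Qed.

(** By [normalised_explicit], [beta] is a multiple of Clifford multiplication or of its [eps]-dual.
    Both are equivariant, so [A] annihilates them; the computation takes the trace. *)
Lemma charge_so b A n : normalised_cocycle (pinor_current R t b) n ->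
  charge b (so_cochain (pinor_current R t b) A n) = 0.
Proof.
move=> /normalised_explicit/explicitP[_ bE _]; rewrite /charge.
have -> : beta_coef (so_cochain (pinor_current R t b) A n) 0 =
    spin A *m beta_coef n 0
    - (so_mx A 0 0 *: beta_coef n 0 + so_mx A 1 0 *: beta_coef n 1)
    - beta_coef n 0 *m spin A.
  apply/matrixP => i j; rewrite mxE beta_so /= /pinor_act !betaE.
  rewrite !mulmx2_entry !e_entry !mulr1 !mulr0 !addr0 !scale1r !scale0r !addr0.
  by rewrite !mulmxA -!mulmxBl -colE mxE.
rewrite !bE spinE [in so_mx A 0 0]soE [in so_mx A 1 0]soE Gamma_starE.
move: (charge b n) (so_mx A 0 1) => c a; rewrite {bE n A} /mxtrace sum2.
rewrite /explicit_beta /Gamma_up invmx_eta.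
case: t b => -[]; rewrite /Omega /sigma1 /sigma3 /= ?sum2 ?mxE2 ?mx2_entry ?mxE2.
all: by rewrite ?mx2_entry ?eps_entry; field.
Qed.

(** * The isomorphism of the cohomology with the trivial module R *)

Variable b : admissible.
Notation kappa := (pinor_current R t b).

Definition spencer_charge (h : spencer kappa 2 2) : R^o := charge b (repr h).

Lemma charge_is_coboundary (f : cochain (pinor R t) 2 2) :
  is_coboundary kappa 2 f -> charge b f = 0.
Proof.
move=> [l lE]; rewrite -(charge_coboundary1 b l); congr charge.
exact/val_inj/esym/lE.
Qed.

(** Two representatives of a class differ by a coboundary, on which the charge vanishes. *)
Lemma spencer_chargeE c :
  spencer_charge (\pi_(spencer kappa 2 2) c)%qT = charge b c.
Proof.
rewrite /spencer_charge; set c' := repr _.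
have : c' - c \in @coboundary_pred R t _ kappa 2 2.
  by apply/(eqlquotP (coboundary_submod kappa 2 2)); exact: reprK.
rewrite !inE => /charge_is_coboundary.
rewrite -[cocycle_val (c' - c)]/(cocycle_val c' - cocycle_val c).
rewrite (linearPB (charge_linear b)) => /eqP; rewrite subr_eq0 => /eqP.
by [].
Qed.

Lemma spencer_charge_linear : linear spencer_charge.
Proof.
have pl := pi_lquot_linear (coboundary_submod kappa 2 2).
move=> a g h; rewrite -[g]reprK -[h]reprK -pl !spencer_chargeE.
exact: charge_linear.
Qed.
HB.instance Definition _ := GRing.isLinear.Build R _ _ _ spencer_charge
  spencer_charge_linear.

(** The normalised part of a representative has the same charge, namely 0, so it is the explicit
    cocycle with parameter 0. The zero cochain is that cocycle too, hence the representative is a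
    coboundary. *)
Lemma spencer_charge_eq0 h : spencer_charge h = 0 -> h = 0.
Proof.
rewrite /spencer_charge -{2}[h]reprK; set c := repr h => q0.
have c0 : ce kappa 2 c = 0 by have := cocycle_valP c; rewrite !inE.
have [n [l [N cE]]] := normalise c0.
have n0 : explicit_cocycle b 0 n.
  have <- : charge b n = 0; last exact: normalised_explicit.
  by rewrite -q0 cE (linearPD (charge_linear b)) charge_coboundary1 addr0.
rewrite -(linearP0 (pi_lquot_linear (coboundary_submod kappa 2 2))).
apply/(eqlquotP (coboundary_submod kappa 2 2)); rewrite subr0 !inE.
exists l; rewrite cE; suff -> : n = 0 by rewrite add0r.
apply: explicit_inj n0 _.
rewrite -[X in explicit_cocycle b X](linearP0 (charge_linear b)).
by apply: normalised_explicit; split=> //; exact: ce0.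
Qed.

(** The action preserves coboundaries, so only the normalised part matters, and [charge_so] covers
    it. *)
Lemma spencer_charge_so A h : spencer_charge (so_spencer A h) = 0.
Proof.
rewrite /so_spencer spencer_chargeE; set c := repr h.
have c0 : ce kappa 2 c = 0 by have := cocycle_valP c; rewrite !inE.
have [n [l [N cE]]] := normalise c0.
rewrite -[cocycle_val (so_cocycle A c)]/(so_cochain kappa A c) cE.
have -> : so_cochain kappa A (n + coboundary1 kappa l) =
    so_cochain kappa A n + so_cochain kappa A (coboundary1 kappa l).
  apply/val_inj; exact: (linearPD (@so_hom_linear _ _ _ kappa 2 A)).
rewrite (linearPD (charge_linear b)) charge_so // add0r.
by apply/charge_is_coboundary/so_coboundary; exists l.
Qed.

Lemma spencer_charge_bij : bijective spencer_charge.
Proof.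
have ex c : exists h, spencer_charge h = c.
  have [f fE] := @explicit_cochain b c.
  have fc : f \in @cocycle_pred R t _ kappa 2 2.
    by rewrite !inE; exact: (explicit_normalised fE).1.
  exists (\pi_(spencer kappa 2 2) (Cocycle fc))%qT.
  by rewrite spencer_chargeE; exact: explicit_charge fE.
(* Explicit cocycles give surjectivity, hence a right inverse by choice; the trivial kernel makes it
   two-sided. *)
have [g gK] := boolp.choice ex.
exists g => // h; apply/eqP; rewrite -subr_eq0; apply/eqP/spencer_charge_eq0.
by rewrite (linearPB spencer_charge_linear) gK subrr.
Qed.
End Pinor.

Theorem proposition3p1 (R : realType) :
  (forall (t : signature) (b : admissible),
    let kappa := pinor_current R t b in
    [/\ exists phi : {linear spencer kappa 2 2 -> R^o},
          bijective phi /\ (forall A h, phi (so_spencer A h) = 0),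
        forall f : cochain (pinor R t) 2 2,
          normalised_cocycle kappa f <-> exists c : R, explicit_cocycle b c f
      & forall c : R, exists f : cochain (pinor R t) 2 2, explicit_cocycle b c f])
  /\
  (exists kappa0 : dirac_current (half_pinor R),
    [/\ nontrivial kappa0,
        forall kappa : dirac_current (half_pinor R), nontrivial kappa ->
          exists2 c : R, c != 0 & forall s s', kappa s s' = c *: kappa0 s s'
      & forall kappa : dirac_current (half_pinor R), nontrivial kappa ->
          forall h : spencer kappa 2 2, h = 0]).
Proof.
split=> [t b kappa|]; last first.
  exists (half_current R); split=> [|kappa nz|kappa nz h].
  - exists (half_gen R), (half_gen R); apply/eqP => /matrixP/(_ 0 0).
    by rewrite /= /half_dirac !mxE /= !mulr1 => /eqP; rewrite oner_eq0.
  (* The factor is read off at the generator, where both coordinates of [half_current] equal 1. *)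
  - exists (kappa (half_gen R) (half_gen R) 0 0); last exact: half_currentE.
    exact: half_current_coef.
  - by apply: spencer_eq0; exact: half_normalised_eq0.
split; last exact: explicit_cochain.
  exists (@spencer_charge R t b); split; first exact: spencer_charge_bij.
  exact: spencer_charge_so.
move=> f; split=> [N|[c E]]; last exact: explicit_normalised E.
by exists (charge b f); exact: normalised_explicit.
Qed.
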